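(* Let $(L,K)$ and $(M,N)$ be admissible pairs of isotropic lines in $\mathbb C^7$. Then for all $\alpha,\beta\in\mathbb C\setminus\mathbb R$ with $\alpha\neq\beta,\bar\beta$ we have $$p_{\alpha,L',K'}\;p_{\beta,M,N}=p_{\beta,M',N'}\;p_{\alpha,L,K},$$ where $$K'=p_{\beta,M,N}(\alpha)K,\qquad L'=(p_{\alpha,K'}*p_{\beta,M,N})(\alpha)L,$$ $$N'=p_{\alpha,L,K}(\beta)N,\qquad M'=(p_{\beta,N'}*p_{\alpha,L,K})(\beta)M.$$
   Context: Let $\mathbb O$ be the octonions, $\mathbb R^7=\mathrm{Im}(\mathbb O)$, $\mathbb C^7=\mathrm{Im}(\mathbb O)\otimes\mathbb C$. Let $\langle\cdot,\cdot\rangle$ be the complex bilinear extension of the standard inner product, with $\perp$ and ''isotropic'' taken with respect to it. For $x,y\in\mathbb C^7$, $x\cdot y\in\mathbb C^7$ is the imaginary part of their octonionic product. A complex coassociative plane is an isotropic $2$-dimensional complex subspace $\mathcal C\subset\mathbb C^7$ with $\mathcal C\cdot\mathcal C=0$. For $\alpha\in\mathbb C\setminus\mathbb R$ and an isotropic line $L$, $p_{\alpha,L}(\lambda)=\frac{\lambda-\bar\alpha}{\lambda-\alpha}\pi_{\bar L}+\pi_{(L\oplus\bar L)^\perp}+\frac{\lambda-\alpha}{\lambda-\bar\alpha}\pi_L$, with projections relative to $\mathbb C^7=L\oplus(L\oplus\bar L)^\perp\oplus\bar L$. A pair $(L,K)$ of isotropic lines is called admissible if $K\subset\bar L^\perp$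 and $L\oplus\pi_{(L\oplus\bar L)^\perp}K$ is a complex coassociative plane; for admissible pairs put $p_{\alpha,L,K}=p_{\alpha,L}p_{\alpha,K}$ (part of the assertion is that the primed pairs are admissible). For an isotropic line $K$, $\gamma\in\mathbb C\setminus\mathbb R$ and a loop $h$ in $\mathrm{SO}(7,\mathbb C)$ holomorphic at $\gamma$, define $p_{\gamma,K}*h=p_{\gamma,K}\,h\,p_{\gamma,h(\gamma)^{-1}K}^{-1}$; this loop is holomorphic at $\gamma$ and can be evaluated there. Thus $p_{\alpha,K'}*p_{\beta,M,N}=p_{\alpha,K'}p_{\beta,M,N}p_{\alpha,K}^{-1}$ and $p_{\beta,N'}*p_{\alpha,L,K}=p_{\beta,N'}p_{\alpha,L,K}p_{\beta,N}^{-1}$. *)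

(* Defs.v *)
From mathcomp Require Import all_boot all_order all_algebra.
From mathcomp Require Import complex.
From mathcomp Require Import boolp classical_sets reals topology normedtype.

Set Implicit Arguments.
Unset Strict Implicit.
Unset Printing Implicit Defensive.

Import Order.TTheory GRing.Theory Num.Theory.
Import numFieldNormedType.Exports.

Local Open Scope classical_set_scope.
Local Open Scope ring_scope.

(* Octonions with coefficients in a commutative ring A, by Cayley-Dickson     *)
(* doubling of the quaternions; A = R gives O and A = C gives O (x) C.        *)
Record quaternion (A : Type) := Quat { q_re : A; q_i : A; q_j : A; q_k : A }.
Record octonion (A : Type) := Oct { o_fst : quaternion A; o_snd : quaternion A }.

Section Octonions.
Variable A : comNzRingType.
Implicit Types (p q : quaternion A) (x y : octonion A) (u v : 'cV[A]_7).

Definition q_add p q : quaternion A :=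
  Quat (q_re p + q_re q) (q_i p + q_i q) (q_j p + q_j q) (q_k p + q_k q).

Definition q_opp p : quaternion A :=
  Quat (- q_re p) (- q_i p) (- q_j p) (- q_k p).

Definition q_conj p : quaternion A :=
  Quat (q_re p) (- q_i p) (- q_j p) (- q_k p).

Definition q_mul p q : quaternion A :=
  Quat (q_re p * q_re q - q_i p * q_i q - q_j p * q_j q - q_k p * q_k q)
       (q_re p * q_i q + q_i p * q_re q + q_j p * q_k q - q_k p * q_j q)
       (q_re p * q_j q - q_i p * q_k q + q_j p * q_re q + q_k p * q_i q)
       (q_re p * q_k q + q_i p * q_j q - q_j p * q_i q + q_k p * q_re q).

(* (a, b) (c, d) = (a c - conj(d) b, d a + b conj(c)) *)
Definition o_mul x y : octonion A :=
  Oct (q_add (q_mul (o_fst x) (o_fst y))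
             (q_opp (q_mul (q_conj (o_snd y)) (o_snd x))))
      (q_add (q_mul (o_snd y) (o_fst x))
             (q_mul (o_snd x) (q_conj (o_fst y)))).

Definition o_of_im u : octonion A :=
  let c k := u (inord k) 0 in
  Oct (Quat 0 (c 0%N) (c 1%N) (c 2%N)) (Quat (c 3%N) (c 4%N) (c 5%N) (c 6%N)).

Definition o_im x : 'cV[A]_7 :=
  \col_k [:: q_i (o_fst x); q_j (o_fst x); q_k (o_fst x);
             q_re (o_snd x); q_i (o_snd x); q_j (o_snd x); q_k (o_snd x)]`_k.

Definition im_mul u v : 'cV[A]_7 := o_im (o_mul (o_of_im u) (o_of_im v)).

Definition dot u v : A := \sum_k u k 0 * v k 0.

End Octonions.

Section Loops.
Variable C : numClosedFieldType.
Implicit Types (U L K : {vspace 'cV[C]_7}) (a g l : C).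

Definition conj_col (v : 'cV[C]_7) : 'cV[C]_7 := map_mx Num.conj v.

Definition conjv U : {vspace 'cV[C]_7} := <<map conj_col (vbasis U)>>%VS.

Definition orthv U : {vspace 'cV[C]_7} :=
  (\bigcap_(u <- vbasis U) lker (linfun (mulmx u^T)))%VS.

Definition imgv (A : 'M[C]_7) U : {vspace 'cV[C]_7} :=
  (linfun (mulmx A) @: U)%VS.

Definition isotropic U : Prop :=
  forall u v, u \in U -> v \in U -> dot u v = 0.

Definition isotropic_line L : Prop := \dim L = 1%N /\ isotropic L.

Definition complex_coassociative U : Prop :=
  [/\ \dim U = 2%N, isotropic U &
      forall u v, u \in U -> v \in U -> im_mul u v = 0].

Definition endmx (f : 'End('cV[C]_7)) : 'M[C]_7 :=
  \matrix_(i, j) f (delta_mx j 0) i 0.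

(* The projections for C^7 = L (+) (L (+) conj L)^orth (+) conj L, meaningful *)
(* when L is an isotropic line.                                               *)
Definition pi_line L : 'M[C]_7 :=
  endmx (daddv_pi L (orthv (L + conjv L) + conjv L)%VS).
Definition pi_orth L : 'M[C]_7 :=
  endmx (daddv_pi (orthv (L + conjv L)) (L + conjv L)%VS).
Definition pi_conj L : 'M[C]_7 :=
  endmx (daddv_pi (conjv L) (L + orthv (L + conjv L))%VS).

Definition admissible L K : Prop :=
  [/\ isotropic_line L, isotropic_line K, (K <= orthv (conjv L))%VS &
      complex_coassociative (L + imgv (pi_orth L) K)%VS].

(* Loops are functions of the spectral parameter; as x / 0 = 0, the values at *)
(* l = a and l = a^* carry no meaning.                                        *)
Definition p1 a L l : 'M[C]_7 :=
  ((l - a^*) / (l - a)) *: pi_conj L + pi_orth L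
  + ((l - a) / (l - a^*)) *: pi_line L.

Definition p2 a L K l : 'M[C]_7 := p1 a L l *m p1 a K l.

(* The product formula is not defined at the (removable) singularity l = g:   *)
(* value_at evaluates the loop there.                                         *)
Definition star g K (h : C -> 'M[C]_7) l : 'M[C]_7 :=
  p1 g K l *m h l *m invmx (p1 g (imgv (invmx (h g)) K) l).

Definition removable_at (f : C -> 'M[C]_7) g : Prop :=
  cvg (f l @[l --> g^']).

Definition value_at (f : C -> 'M[C]_7) g : 'M[C]_7 :=
  lim (f l @[l --> g^']).

Lemma conj_colK : involutive conj_col.
Proof. by move=> v; apply/matrixP=> i j; rewrite !mxE conjCK. Qed.

Lemma memv_conjv U v : (v \in conjv U) = (conj_col v \in U).
Proof.
have sub (W : {vspace 'cV[C]_7}) (w : 'cV[C]_7) :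
    w \in W -> conj_col w \in conjv W.
  move=> /coord_vbasis ->; rewrite /conj_col raddf_sum /= memv_suml // => i _.
  have -> : map_mx Num.conj (coord (vbasis W) i w *: (vbasis W)`_i) =
      (coord (vbasis W) i w)^* *: conj_col (vbasis W)`_i.
    by apply/matrixP=> r c; rewrite !mxE rmorphM.
  by rewrite memvZ // memv_span // map_f // mem_nth // size_tuple.
apply/idP/idP => [|/sub]; last by rewrite conj_colK.
move=> /(@coord_span _ _ _ (map_tuple conj_col (vbasis U))) ->.
rewrite /conj_col raddf_sum /= memv_suml // => i _.
rewrite (nth_map 0) ?size_tuple //.
set c := coord _ _ _.
have -> : map_mx Num.conj (c *: conj_col (vbasis U)`_i) =
    c^* *: (vbasis U)`_i.
  by apply/matrixP=> r s; rewrite !mxE rmorphM /= conjCK.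
by rewrite memvZ // vbasis_mem // mem_nth // size_tuple.
Qed.

Lemma memv_orthv U v :
  v \in orthv U <-> forall u, u \in U -> dot u v = 0.
Proof.
have lkE (u : 'cV[C]_7) : (v \in lker (linfun (mulmx u^T))) = (dot u v == 0).
  rewrite memv_ker lfunE /=; apply/eqP/eqP => [/matrixP/(_ 0 0)|e].
    by rewrite !mxE => e; rewrite -[RHS]e; apply: eq_bigr => i _; rewrite mxE.
  apply/matrixP=> i j; rewrite !ord1 !mxE -[RHS]e.
  by apply: eq_bigr => k _; rewrite mxE.
have orthE (s : seq 'cV[C]_7) :
    (v \in (\bigcap_(u <- s) lker (linfun (mulmx u^T)))%VS) =
    all (fun u => dot u v == 0) s.
  by elim: s => [|u s IHs]; rewrite ?big_nil ?memvf // big_cons memv_cap lkE IHs.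
rewrite /orthv orthE; split => [/allP Uv u /coord_vbasis ->|Uv]; last first.
  by apply/allP => u /vbasis_mem /Uv ->.
rewrite /dot; under eq_bigr do rewrite summxE mulr_suml.
rewrite exchange_big big1 //= => i _.
under eq_bigr do rewrite mxE -mulrA.
have /Uv/eqP : (vbasis U)`_i \in vbasis U by rewrite mem_nth ?size_tuple.
by rewrite /dot -mulr_sumr => ->; rewrite mulr0.
Qed.

Lemma mul_endmx (f : 'End('cV[C]_7)) v : endmx f *m v = f v.
Proof.
rewrite {2}[v]matrix_sum_delta linear_sum; apply/matrixP=> i j.
rewrite !mxE summxE; apply: eq_bigr => k _.
by rewrite big_ord1 linearZ !mxE mulrC !ord1.
Qed.

End Loops.

(* Main.v *)
Require Import Defs.
From mathcomp Require Import all_boot all_order all_algebra.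
From mathcomp Require Import complex ring ssrAC.
From mathcomp Require Import boolp classical_sets reals topology normedtype.

Set Implicit Arguments.
Unset Strict Implicit.
Unset Printing Implicit Defensive.

Import Order.TTheory GRing.Theory Num.Theory.
Local Open Scope ring_scope.

(** Write a, b for alpha, beta, and put K1 = p_{b,N}(a) K, N1 = p_{a,K}(b) N.
    For single factors,

      p_{a,K1} p_{b,N} = p_{b,N1} p_{a,K}        ([loop2_permute]).

    Both sides are rational in the spectral parameter, equal to the identity at
    infinity, with simple poles at a, b and their conjugates. Comparing residues
    leaves one identity, [loop2_residue]: p_{b,N1}(a) sends the conjugate of K
    to the conjugate of K1, with an explicit factor.

    Applied twice, this gives p_{a,K'} p_{b,M,N} = p_{b,M1} p_{b,N1} p_{a,K}
    with M1 = p_{a,K1}(b) M. So the loop p_{a,K'} * p_{b,M,N} is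
    p_{b,M1} p_{b,N1}, which is regular at a ([star_cvg]); this determines L',
    and in the same way M'. The asserted identity is then a chain of four single
    permutations.

    The substance is the admissibility of (L', K'); that of (M', N') follows
    by symmetry. First, p_{b,M,N} takes values in the automorphisms of the
    product ([hrot_hrot_preserves_triple]). Let U be the span of M, of the
    component N0 of N orthogonal to M and its conjugate, and of the conjugates
    of M and N0. The trilinear form <x y, z> vanishes on U, the orthogonal of U
    is closed under the product and fixed by the loop, and the loop acts on the
    plane spanned by N0 and the conjugate of M with determinant one; since the
    products of U are invariant under this SL_2 ([frame_diag]), the trilinear
    form is preserved. Second, admissibility is symmetric ([adm_pair_sym]): the
    product of L with the orthogonal part of K vanishes if and only if the
    product of K with the orthogonal part of L does. In the second form it
    passes from (L, K) to (L', K'): p_{b,M,N}(a) sends K to K', and sends the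
    orthogonal part of L to that of L' up to an element of K'
    ([dressing_adm_pair]). *)

(** * The bilinear form and the product of imaginary octonions *)

Section Dot.
Variable A : comNzRingType.
Implicit Types (u v w : 'cV[A]_7) (c : A).

Lemma dotC u v : dot u v = dot v u.
Proof. by apply: eq_bigr => i _; rewrite mulrC. Qed.

Lemma dotDl u v w : dot (u + v) w = dot u w + dot v w.
Proof. by rewrite -big_split; apply: eq_bigr => i _; rewrite mxE mulrDl. Qed.

Lemma dotZl c u w : dot (c *: u) w = c * dot u w.
Proof. by rewrite /dot mulr_sumr; apply: eq_bigr => i _; rewrite mxE mulrA. Qed.

Lemma dotDr u v w : dot w (u + v) = dot w u + dot w v.
Proof. by rewrite dotC dotDl !(dotC w). Qed.

Lemma dotZr c u w : dot w (c *: u) = c * dot w u.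
Proof. by rewrite dotC dotZl (dotC w). Qed.

Lemma dotNl u w : dot (- u) w = - dot u w.
Proof. by rewrite -scaleN1r dotZl mulN1r. Qed.

Lemma dotNr u w : dot w (- u) = - dot w u.
Proof. by rewrite dotC dotNl dotC. Qed.

Lemma dot0l w : dot 0 w = 0.
Proof. by rewrite -(scale0r w) dotZl mul0r. Qed.

Lemma dot0r w : dot w 0 = 0.
Proof. by rewrite dotC dot0l. Qed.

Lemma trmx_mul_dot u v : u^T *m v = (dot u v)%:M.
Proof.
by apply/matrixP=> i j; rewrite !ord1 !mxE; apply: eq_bigr => k _; rewrite mxE.
Qed.

Lemma dot_nondeg u : (forall w, dot u w = 0) -> u = 0.
Proof.
move=> u0; apply/matrixP=> i j; rewrite ord1 mxE -(u0 (delta_mx i 0)) /dot.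
rewrite (bigD1 i) //= !mxE !eqxx mulr1 big1 ?addr0 // => k /negPf ki.
by rewrite mxE ki mulr0.
Qed.

Let coord u (n : nat) := u (inord n) 0.

Let dotE u v : dot u v =
  coord u 0 * coord v 0 + (coord u 1 * coord v 1 + (coord u 2 * coord v 2 +
  (coord u 3 * coord v 3 + (coord u 4 * coord v 4 + (coord u 5 * coord v 5 +
   coord u 6 * coord v 6))))).
Proof.
rewrite /dot !big_ord_recl big_ord0 addr0 /coord.
by do ![congr (_ + _)|congr (_ * _)]; congr (_ _ _); apply: val_inj;
  rewrite /= inordK.
Qed.

Let mulE u v (n : nat) : (n < 7)%N -> coord (im_mul u v) n =
 [:: q_i (o_fst (o_mul (o_of_im u) (o_of_im v)));
     q_j (o_fst (o_mul (o_of_im u) (o_of_im v)));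
     q_k (o_fst (o_mul (o_of_im u) (o_of_im v)));
     q_re (o_snd (o_mul (o_of_im u) (o_of_im v)));
     q_i (o_snd (o_mul (o_of_im u) (o_of_im v)));
     q_j (o_snd (o_mul (o_of_im u) (o_of_im v)));
     q_k (o_snd (o_mul (o_of_im u) (o_of_im v)))]`_n.
Proof. by move=> n7; rewrite /coord !mxE inordK. Qed.

Let eq_coord u v : (forall n, (n < 7)%N -> coord u n = coord v n) -> u = v.
Proof.
move=> uv; apply/matrixP=> i j; rewrite ord1.
by have := uv i (ltn_ord i); rewrite /coord inord_val.
Qed.

Lemma im_mulDl u v w : im_mul (u + v) w = im_mul u w + im_mul v w.
Proof.
apply: eq_coord => n n7; rewrite [RHS]mxE -!/(coord _ _) !mulE //.
by move: n n7; do 7?[case] => //= _; rewrite !mxE; ring.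
Qed.

Lemma im_mulC u v : im_mul u v = - im_mul v u.
Proof.
apply: eq_coord => n n7; rewrite [RHS]mxE -!/(coord _ _) !mulE //.
by move: n n7; do 7?[case] => //= _; ring.
Qed.

Lemma im_mulZl c u w : im_mul (c *: u) w = c *: im_mul u w.
Proof.
apply: eq_coord => n n7; rewrite [RHS]mxE -!/(coord _ _) !mulE //.
by move: n n7; do 7?[case] => //= _; rewrite !mxE; ring.
Qed.

Lemma im_mul_alt u : im_mul u u = 0.
Proof.
apply: eq_coord => n n7; rewrite [RHS]mxE !mulE //.
by move: n n7; do 7?[case] => //= _; ring.
Qed.

Lemma dot_mulA u v w : dot (im_mul u v) w = dot u (im_mul v w).
Proof. by rewrite !dotE !mulE //= /coord; ring. Qed.

(** The polarization of u (u v) = - <u, u> v, which is alternativity of the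
    octonions seen on imaginary parts. With bilinearity and the total
    antisymmetry of <u v, w>, it yields every relation between products below. *)
Lemma im_mul_mul u v w :
  im_mul u (im_mul v w) + im_mul v (im_mul u w) =
  - (2 * dot u v) *: w + dot u w *: v + dot v w *: u.
Proof.
apply: eq_coord => n n7.
have -> a b (p q r : 'cV[A]_7) :
    coord (- a *: p + b *: q + dot v w *: r) n =
    - a * coord p n + b * coord q n + dot v w * coord r n.
  by rewrite /coord !mxE.
rewrite [LHS]mxE -!/(coord _ _) !dotE mulE // [X in _ + X]mulE //.
move: n n7; do 7?[case] => //= _;
  by rewrite -!/(coord _ _) !mulE //= /coord; ring.
Qed.
End Dot.

(** * Simple factors and their permutability *)

Section SimpleFactors.
Variable F : fieldType.
Implicit Types (k m n u v w : 'cV[F]_7) (p q x y z : F).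

Definition proj k m : 'M[F]_7 := (dot k m)^-1 *: (m *m k^T).

Lemma projE k m v : proj k m *m v = (dot k v / dot k m) *: m.
Proof.
by rewrite -scalemxAl -mulmxA trmx_mul_dot mul_mx_scalar scalerA mulrC.
Qed.

(** The algebra of simple factors only uses that the conjugate of k is an
    isotropic vector that pairs with k; with two independent vectors k and m,
    conjugation becomes the exchange of k and m. *)
Definition hyp_pair k m := [/\ dot k k = 0, dot m m = 0 & dot k m != 0].

Lemma hyp_pairC k m : hyp_pair k m -> hyp_pair m k.
Proof. by case=> kk mm km; split=> //; rewrite dotC. Qed.

(** On a hyperbolic pair this is the scaling by 1 + p on the line of m, by
    1 + q on the line of k, and by 1 on their orthogonal. *)
Definition hrot p q k m : 'M[F]_7 := 1%:M + p *: proj k m + q *: proj m k.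

Lemma hrotE p q k m v : hrot p q k m *m v =
  v + (p * dot k v / dot k m) *: m + (q * dot m v / dot k m) *: k.
Proof.
rewrite !mulmxDl mul1mx -(scalemxAl p) -(scalemxAl q) !projE !scalerA.
by rewrite !mulrA (dotC m k).
Qed.

Lemma hrotC p q k m : hrot p q k m = hrot q p m k.
Proof. by rewrite /hrot addrAC. Qed.

(** Isometry, because the hypothesis says (1 + p) (1 + q) = 1. *)
Lemma dot_hrot p q k m u v : hyp_pair k m -> p + q + p * q = 0 ->
  dot (hrot p q k m *m u) (hrot p q k m *m v) = dot u v.
Proof.
case=> kk mm km pq; rewrite !hrotE !(dotDl, dotDr, dotZl, dotZr) kk mm.
rewrite (dotC m k) (dotC u k) (dotC u m).
transitivity (dot u v + (p + q + p * q) *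
    ((dot k u * dot m v + dot m u * dot k v) / dot k m)); first by field.
by rewrite pq mul0r addr0.
Qed.

(** The simple factor p_{x,L} for L the line of k, when y and m are the
    conjugates of x and k. Its weights (z - y) / (z - x) and their inverses are
    written as 1 plus a simple pole, in view of the comparison of residues. *)
Definition loop2 x y k m z := hrot ((x - y) / (z - x)) ((y - x) / (z - y)) k m.

Lemma loop2C x y k m z : loop2 x y k m z = loop2 y x m k z.
Proof. exact: hrotC. Qed.

Lemma loop2_weights {x y z} : z != x -> z != y ->
  (x - y) / (z - x) + (y - x) / (z - y) +
  (x - y) / (z - x) * ((y - x) / (z - y)) = 0.
Proof.
rewrite -!(subr_eq0 z) => zx zy; field.
by rewrite zx zy.
Qed.

Lemma dot_loop2 x y k m z u v : hyp_pair k m -> z != x -> z != y ->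
  dot (loop2 x y k m z *m u) (loop2 x y k m z *m v) = dot u v.
Proof. by move=> km zx zy; apply/dot_hrot/loop2_weights. Qed.

(** The norms of the two dressed vectors. The correction to <k, k'> involves
    the two pairs symmetrically, except for the division by <n, n'>; hence
    [dot_dressed_ratio]. *)
Lemma dot_dressed {x x' y y' k k' n n'} : hyp_pair n n' ->
  x != y -> x != y' -> x' != y -> x' != y' ->
  dot (loop2 y y' n n' x *m k) (loop2 y y' n n' x' *m k') =
  dot k k' + (x' - x) * (y' - y) / dot n n' *
    (dot k' n * dot k n' / ((x' - y) * (x - y')) -
     dot k' n' * dot k n / ((x' - y') * (x - y))).
Proof.
move=> [nn nn' bn]; rewrite -!(subr_eq0 x) -!(subr_eq0 x') => xy xy' x'y x'y'.
rewrite /loop2 !hrotE !(dotDl, dotDr, dotZl, dotZr).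
rewrite nn nn' (dotC n' n) (dotC n k) (dotC n k') (dotC n' k) (dotC n' k').
by field; rewrite bn xy xy' x'y x'y'.
Qed.

(** The identity behind permutability: dressing n by k is exactly what
    makes the dressed factor send k' to the line of the dressed k'. *)
Lemma loop2_residue {x x' y y' k k' n n'} :
  hyp_pair k k' -> hyp_pair n n' ->
  x != y -> x != y' -> x' != y -> x' != y' ->
  let n1 := loop2 x x' k k' y *m n in
  let n1' := loop2 x x' k k' y' *m n' in
  dot n1 n1' != 0 ->
  loop2 y y' n1 n1' x *m k' =
  (dot n n' / dot n1 n1') *: (loop2 y y' n n' x' *m k').
Proof.
move=> hk [nn nn' bn] xy xy' x'y x'y' n1 n1'.
have b1E : dot n1 n1' = dot n n' + (y' - y) * (x' - x) / dot k k' *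
    (dot k n' * dot k' n / ((y' - x) * (y - x')) -
     dot k' n' * dot k n / ((y' - x') * (y - x))).
  rewrite (dotC k n') (dotC k' n) (dotC k' n') (dotC k n).
  by apply: dot_dressed; rewrite // eq_sym.
have [kk kk' ak] := hk.
rewrite -!(subr_eq0 x) -!(subr_eq0 x') in xy xy' x'y x'y'.
have [yx y'x yx' y'x'] :
    [/\ y - x != 0, y' - x != 0, y - x' != 0 & y' - x' != 0].
  by rewrite -!(opprB x) -!(opprB x') !oppr_eq0.
rewrite hrotE b1E => b10.
apply: (scalerI b10); rewrite scalerA [X in _ = X *: _]mulrC divfK //.
apply/matrixP=> i j; rewrite /n1 /n1' /loop2 !hrotE !mxE !ord1.
rewrite !(dotDl, dotDr, dotZl, dotZr) kk' (dotC n k') (dotC n' k').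
field.
rewrite bn ak xy xy' x'y x'y' yx y'x yx' y'x' /= andbT.
have D0 : dot k k' * ((y' - x) * (y - x') * ((y' - x') * (y - x))) != 0.
  by rewrite !mulf_neq0.
move: (mulf_neq0 b10 D0); congr (is_true (_ != 0)).
by field; rewrite ak yx y'x yx' y'x'.
Qed.

Lemma dot_dressed_ratio {x x' y y' k k' n n'} :
  hyp_pair k k' -> hyp_pair n n' ->
  x != y -> x != y' -> x' != y -> x' != y' ->
  dot (loop2 y y' n n' x *m k) (loop2 y y' n n' x' *m k') / dot k k' =
  dot (loop2 x x' k k' y *m n) (loop2 x x' k k' y' *m n') / dot n n'.
Proof.
move=> hk hn xy xy' x'y x'y'.
rewrite (dot_dressed hn) // (dot_dressed hk) 1?eq_sym //.
rewrite (dotC n' k) (dotC n k') (dotC n' k') (dotC n k).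
case: hk hn => _ _ ak [_ _ bn].
rewrite -!(subr_eq0 x) -!(subr_eq0 x') in xy xy' x'y x'y'.
field.
rewrite bn ak xy xy' x'y x'y' -!(opprB x) -!(opprB x') !oppr_eq0.
by rewrite xy xy' x'y x'y'.
Qed.

Lemma mulmx_ext (A B : 'M[F]_7) :
  (forall v : 'cV_7, A *m v = B *m v) -> A = B.
Proof.
move=> AB; apply/matrixP=> i j.
by have /matrixP/(_ i 0) := AB (delta_mx j 0); rewrite -!colE !mxE.
Qed.

(** Equality at z = x of the residues of the two sides of [loop2_permute]. *)
Lemma proj_intertwine {x x' y y' k k' n n'} :
  hyp_pair k k' -> hyp_pair n n' ->
  x != y -> x != y' -> x' != y -> x' != y' ->
  let k1 := loop2 y y' n n' x *m k in
  let k1' := loop2 y y' n n' x' *m k' in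
  let n1 := loop2 x x' k k' y *m n in
  let n1' := loop2 x x' k k' y' *m n' in
  dot n1 n1' != 0 ->
  proj k1 k1' *m loop2 y y' n n' x = loop2 y y' n1 n1' x *m proj k k'.
Proof.
move=> hk hn xy xy' x'y x'y' k1 k1' n1 n1' b10; apply: mulmx_ext => v.
rewrite -!mulmxA (projE k1) (projE k) -scalemxAr.
rewrite (loop2_residue hk hn xy xy' x'y x'y' b10).
rewrite /k1 (dot_loop2 _ _ hn xy xy') scalerA.
congr (_ *: _); rewrite -!mulrA; congr (_ * _).
have := dot_dressed_ratio hk hn xy xy' x'y x'y'.
rewrite -/k1 -/k1' -/n1 -/n1' => /(congr1 GRing.inv).
rewrite !invf_div => <-; case: hk => _ _ ak.
by rewrite mulKf.
Qed.

(** Each residue is the residue of one factor times the value of the other. *)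
Lemma partial_fractions (A A' B B' : 'M[F]_7) (a a' b b' : F) {x x' y y' z} :
  x != y -> x != y' -> x' != y -> x' != y' ->
  z != x -> z != x' -> z != y -> z != y' ->
  (1%:M + (a / (z - x)) *: A + (a' / (z - x')) *: A') *m
  (1%:M + (b / (z - y)) *: B + (b' / (z - y')) *: B') =
  1%:M
  + (a / (z - x)) *:
      (A *m (1%:M + (b / (x - y)) *: B + (b' / (x - y')) *: B'))
  + (a' / (z - x')) *:
      (A' *m (1%:M + (b / (x' - y)) *: B + (b' / (x' - y')) *: B'))
  + (b / (z - y)) *:
      ((1%:M + (a / (y - x)) *: A + (a' / (y - x')) *: A') *m B)
  + (b' / (z - y')) *:
      ((1%:M + (a / (y' - x)) *: A + (a' / (y' - x')) *: A') *m B').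
Proof.
rewrite -!(subr_eq0 x) -!(subr_eq0 x') -!(subr_eq0 z).
move=> xy xy' x'y x'y' zx zx' zy zy'.
rewrite !(mulmxDl, mulmxDr, mul1mx, mulmx1) -!scalemxAr -!scalemxAl.
move: (A *m B) (A *m B') (A' *m B) (A' *m B') => AB AB' A'B A'B'.
apply/matrixP=> i j; rewrite !mxE; field.
rewrite xy xy' x'y x'y' zx zx' zy zy' -!(opprB x) -!(opprB x') !oppr_eq0.
by rewrite xy xy' x'y x'y'.
Qed.

(** Both sides tend to the identity at infinity and have simple poles at x, x',
    y, y', so it is enough that their residues agree. *)
Lemma loop2_permute {x x' y y' k k' n n'} z :
  hyp_pair k k' -> hyp_pair n n' ->
  x != y -> x != y' -> x' != y -> x' != y' ->
  let k1 := loop2 y y' n n' x *m k in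
  let k1' := loop2 y y' n n' x' *m k' in
  let n1 := loop2 x x' k k' y *m n in
  let n1' := loop2 x x' k k' y' *m n' in
  dot n1 n1' != 0 ->
  z != x -> z != x' -> z != y -> z != y' ->
  loop2 x x' k1 k1' z *m loop2 y y' n n' z =
  loop2 y y' n1 n1' z *m loop2 x x' k k' z.
Proof.
move=> hk hn xy xy' x'y x'y' k1 k1' n1 n1' b10 zx zx' zy zy'.
have a10 : dot k1 k1' != 0.
  have := dot_dressed_ratio hk hn xy xy' x'y x'y'.
  rewrite -/k1 -/k1' -/n1 -/n1' => e; case: hk hn => _ _ ak [_ _ bn].
  apply: contra_neq b10 => a10; move/eqP: e.
  by rewrite a10 mul0r eq_sym mulf_eq0 invr_eq0 (negPf bn) orbF => /eqP.
have [yx yx' y'x y'x'] : [/\ y != x, y != x', y' != x & y' != x'].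
  by split; rewrite eq_sym.
have hk' := hyp_pairC hk; have hn' := hyp_pairC hn.
have e1 := proj_intertwine hk hn xy xy' x'y x'y' b10.
(* Exchanging primed and unprimed data turns the residue at x into the one
   at x', and the residue at y into the one at y'. *)
have e2 :
    proj k1' k1 *m loop2 y y' n n' x' = loop2 y y' n1 n1' x' *m proj k' k.
  have := proj_intertwine hk' hn' x'y' x'y xy' xy.
  cbv zeta; rewrite !(loop2C x') !(loop2C y') -/k1 -/k1' -/n1 -/n1' (dotC _ _).
  by apply.
have e3 : proj n1 n1' *m loop2 x x' k k' y = loop2 x x' k1 k1' y *m proj n n'.
  exact: (proj_intertwine hn hk yx yx' y'x y'x' a10).
have e4 :
    proj n1' n1 *m loop2 x x' k k' y' = loop2 x x' k1 k1' y' *m proj n' n.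
  have := proj_intertwine hn' hk' y'x' y'x yx' yx.
  cbv zeta; rewrite !(loop2C x') !(loop2C y') -/k1 -/k1' -/n1 -/n1' (dotC _ _).
  by apply.
rewrite /loop2 /hrot.
rewrite (partial_fractions (proj k1 k1') (proj k1' k1) (proj n n') (proj n' n)
  _ _ _ _ xy xy' x'y x'y' zx zx' zy zy').
rewrite (partial_fractions (proj n1 n1') (proj n1' n1) (proj k k') (proj k' k)
  _ _ _ _ yx yx' y'x y'x' zy zy' zx zx').
move: e1 e2 e3 e4; rewrite /loop2 /hrot -/k1 -/k1' -/n1 -/n1' => -> -> -> ->.
by rewrite [RHS](ACl (1*4*5*2*3)%AC).
Qed.
End SimpleFactors.

(** * Four vectors spanning a coassociative four-space *)

Section Products.
Variable F : numFieldType.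
Implicit Types (k l m n u v w e : 'cV[F]_7) (p q x y z : F).

Lemma im_mulDr u v w : im_mul u (v + w) = im_mul u v + im_mul u w.
Proof. by rewrite im_mulC im_mulDl opprD -(im_mulC u v) -(im_mulC u w). Qed.

Lemma im_mulZr p u w : im_mul u (p *: w) = p *: im_mul u w.
Proof. by rewrite im_mulC im_mulZl -scalerN -(im_mulC u w). Qed.

Lemma im_mul0r u : im_mul u 0 = 0.
Proof. by rewrite -(scale0r 0) im_mulZr !scale0r. Qed.

Lemma im_mulNr u w : im_mul u (- w) = - im_mul u w.
Proof. by rewrite -scaleN1r im_mulZr scaleN1r. Qed.

Lemma dot_mul_alt u v : dot u (im_mul u v) = 0.
Proof. by rewrite -dot_mulA im_mul_alt dot0l. Qed.

Lemma im_mul_swap u v w : im_mul u (im_mul v w) =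
  - im_mul v (im_mul u w) - (2 * dot u v) *: w + dot u w *: v + dot v w *: u.
Proof.
have := im_mul_mul u v w => /(congr1 (+%R (- im_mul v (im_mul u w)))).
by rewrite addrCA addNr addr0 scaleNr !addrA => ->.
Qed.

Lemma im_mul_twice u v : im_mul u (im_mul u v) = dot u v *: u - dot u u *: v.
Proof.
have /(congr1 (fun w => 2^-1 *: w)) := im_mul_mul u u v.
rewrite -mulr2n -scaler_nat scalerA mulVf ?pnatr_eq0 // scale1r => ->.
by apply/matrixP=> i j; rewrite !mxE; field; rewrite ?pnatr_eq0.
Qed.

(** A complex coassociative plane <l, k> and its conjugate plane <l', k'>, in
    bases that are dual up to scalars. The conditions are stable under the
    exchange of primed and unprimed vectors (conjugation) and under the
    exchange of l and k, so that each computation is done for l alone. *)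
Record coassoc_frame l l' k k' : Prop := CoassocFrame {
  frame_l : hyp_pair l l';
  frame_k : hyp_pair k k';
  frame_lk : dot l k = 0;
  frame_lk' : dot l k' = 0;
  frame_l'k : dot l' k = 0;
  frame_l'k' : dot l' k' = 0;
  frame_mul : im_mul l k = 0;
  frame_mul' : im_mul l' k' = 0 }.

Lemma frame_conj l l' k k' :
  coassoc_frame l l' k k' -> coassoc_frame l' l k' k.
Proof. by case=> *; split=> //; exact: hyp_pairC. Qed.

Lemma frame_swap l l' k k' :
  coassoc_frame l l' k k' -> coassoc_frame k k' l l'.
Proof.
by case=> hl hk *; split; rewrite // 1?dotC // im_mulC ?oppr_eq0;
  apply/eqP; rewrite oppr_eq0; apply/eqP.
Qed.

(** For this multiple of l l', the product with l vanishes; [frame_diag]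
    deduces that the vector itself vanishes, being killed by both l and l'. *)
Lemma frame_diag_ann l l' k k' : coassoc_frame l l' k k' ->
  im_mul l (im_mul k k' + (dot k k' / dot l l') *: im_mul l l') = 0.
Proof.
case=> [[ll ll' a0] [kk kk' b0] lk lk' l'k l'k' mlk ml'k'].
rewrite im_mulDr im_mulZr im_mul_twice ll (im_mul_swap l k) lk lk'.
rewrite (im_mulC l k') im_mulNr (im_mul_swap k k').
rewrite (im_mulC k l) mlk oppr0 im_mul0r (dotC k l) lk (dotC k' l) lk'.
by apply/matrixP=> i j; rewrite !mxE; field.
Qed.

(** The relation that makes SL_2, acting on the plane <k, l'> and dually on
    <l, k'>, preserve the product: the products k k' and l' l are given by
    the pairing between the two planes. *)
Lemma frame_diag l l' k k' : coassoc_frame l l' k k' ->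
  im_mul k k' = - (dot k k' / dot l l') *: im_mul l l'.
Proof.
move=> fr; have := frame_diag_ann fr; have := frame_diag_ann (frame_conj fr).
case: fr => [[ll ll' a0] [kk kk' b0] lk lk' l'k l'k' mlk ml'k'].
rewrite (dotC k') (dotC l') (im_mulC k' k) (im_mulC l' l) scalerN -opprD.
set d := im_mul k k' + _ => l'd ld.
suff d0 : d = 0 by apply/eqP; rewrite scaleNr -addr_eq0; apply/eqP.
have {}l'd : im_mul l' d = 0.
  by apply/eqP; rewrite -oppr_eq0 -im_mulNr l'd.
have l_d : dot l d = 0.
  by rewrite dotDr dotZr dot_mul_alt -dot_mulA mlk dot0l mulr0 addr0.
have l'_d : dot l' d = 0.
  rewrite dotDr dotZr (im_mulC k) (im_mulC l) !dotNr -dot_mulA ml'k' dot0l.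
  by rewrite dot_mul_alt oppr0 mulr0 addr0.
have := im_mul_swap l l' d.
rewrite ld l'd !im_mul0r oppr0 l_d l'_d !scale0r !addr0 sub0r => /esym/eqP.
by rewrite oppr_eq0 scaler_eq0 mulf_eq0 pnatr_eq0 (negPf a0) => /eqP.
Qed.

Lemma frame_mul_span l l' k k' x1 x2 x3 x4 y1 y2 y3 y4 :
  coassoc_frame l l' k k' ->
  im_mul (x1 *: l + x2 *: l' + x3 *: k + x4 *: k')
         (y1 *: l + y2 *: l' + y3 *: k + y4 *: k') =
  (x1 * y2 - x2 * y1 - dot k k' / dot l l' * (x3 * y4 - x4 * y3)) *: im_mul l l'
  + (x1 * y4 - x4 * y1) *: im_mul l k' + (x2 * y3 - x3 * y2) *: im_mul l' k.
Proof.
move=> fr; have kk' := frame_diag fr; case: fr => _ _ _ _ _ _ mlk ml'k'.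
rewrite !(im_mulDl, im_mulDr, im_mulZl, im_mulZr) !im_mul_alt.
rewrite (im_mulC k' k) (im_mulC l' l) (im_mulC k l) (im_mulC k' l).
rewrite (im_mulC k l') (im_mulC k' l') mlk ml'k' kk'.
by apply/matrixP=> i j; rewrite !mxE; ring.
Qed.

End Products.

Lemma dual_basis_expansion (F : fieldType) (v w : 'I_7 -> 'cV[F]_7) x :
  (forall i j, dot (w i) (v j) = (i == j)%:R) ->
  x = \sum_j dot (w j) x *: v j.
Proof.
move=> wv; pose V := \matrix_(i, j) v j i 0; pose W := \matrix_(i, j) w i j 0.
have /mulmx1C VW : W *m V = 1%:M.
  apply/matrixP=> i j; rewrite !mxE -wv; apply: eq_bigr => h _.
  by rewrite !mxE.
rewrite -[LHS]mul1mx -VW -mulmxA; apply/matrixP=> i j; rewrite ord1 !mxE.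
rewrite summxE; apply: eq_bigr => h _; rewrite !mxE mulrC; congr (_ * _).
by apply: eq_bigr => h' _; rewrite !mxE.
Qed.

Section Frame.
Variable F : numFieldType.
Implicit Types (k l u v w e : 'cV[F]_7) (x y z : 'rV[F]_4).

Lemma dot_mulr u v w : dot (im_mul u v) w = - dot v (im_mul u w).
Proof. by rewrite im_mulC dotNl dot_mulA. Qed.

Lemma frame_perp_mixed l l' k k' : coassoc_frame l l' k k' ->
  [/\ dot l (im_mul l k') = 0, dot l' (im_mul l k') = 0,
      dot k (im_mul l k') = 0 & dot k' (im_mul l k') = 0].
Proof.
case=> _ _ _ _ _ _ mlk ml'k'; rewrite dot_mul_alt; split=> //.
- by rewrite dotC dot_mulA im_mulC ml'k' oppr0 dot0r.
- by rewrite -dot_mulA im_mulC mlk oppr0 dot0l.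
- by rewrite dotC dot_mulA im_mul_alt dot0r.
Qed.

Lemma frame_perp_diag l l' k k' : coassoc_frame l l' k k' ->
  [/\ dot l (im_mul l l') = 0, dot l' (im_mul l l') = 0,
      dot k (im_mul l l') = 0 & dot k' (im_mul l l') = 0].
Proof.
case=> _ _ _ _ _ _ mlk ml'k'; rewrite dot_mul_alt; split=> //.
- by rewrite im_mulC dotNr dot_mul_alt oppr0.
- by rewrite -dot_mulA im_mulC mlk oppr0 dot0l.
- by rewrite im_mulC dotNr -dot_mulA im_mulC ml'k' oppr0 dot0l oppr0.
Qed.

(** Left multiplication by l on the basis l k', l' k, l l' of the orthogonal
    of the frame. *)
Lemma frame_mul_l l l' k k' : coassoc_frame l l' k k' ->
  [/\ im_mul l (im_mul l k') = 0,
      im_mul l (im_mul l' k) = - (2 * dot l l') *: k &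
      im_mul l (im_mul l l') = dot l l' *: l].
Proof.
case=> [[ll _ _] _ lk lk' l'k _ mlk ml'k'].
rewrite !im_mul_twice ll lk' !scale0r !subr0 (im_mul_swap l l') mlk im_mul0r.
by rewrite lk l'k !scale0r !addr0 oppr0 sub0r scaleNr.
Qed.

Lemma frame_gram l l' k k' : coassoc_frame l l' k k' ->
  [/\ dot (im_mul l k') (im_mul l k') = 0,
      dot (im_mul l k') (im_mul l' k) = 2 * dot l l' * dot k k',
      dot (im_mul l k') (im_mul l l') = 0 &
      dot (im_mul l l') (im_mul l l') = - dot l l' ^+ 2].
Proof.
move=> fr; have [lm lm' ln] := frame_mul_l fr.
case: fr => _ _ _ lk' _ _ _ _.
rewrite !dot_mulr lm lm' ln dot0r !dotZr.
rewrite (dotC k' l) lk' (dotC l' l) (dotC k' k).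
by split; ring.
Qed.

Definition perp_frame l l' k k' e :=
  [/\ dot l e = 0, dot l' e = 0, dot k e = 0 & dot k' e = 0].

(** The four vectors of the frame and the products l k', l' k, l l' have an
    invertible Gram matrix. Being seven, they form a basis: this is where the
    dimension of the space enters. *)
Lemma frame_expansion l l' k k' e :
  coassoc_frame l l' k k' -> perp_frame l l' k k' e ->
  e = (dot (im_mul l' k) e / (2 * dot l l' * dot k k')) *: im_mul l k'
    + (dot (im_mul l k') e / (2 * dot l l' * dot k k')) *: im_mul l' k
    - (dot (im_mul l l') e / dot l l' ^+ 2) *: im_mul l l'.
Proof.
move=> fr [le l'e ke k'e].
have [lm l'm km k'm] := frame_perp_mixed fr.
have [l'm' lm' k'm' km'] := frame_perp_mixed (frame_conj fr).
have [ln l'n kn k'n] := frame_perp_diag fr.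
have [mm mm' mn nn] := frame_gram fr.
have [m'm' _ m'n _] := frame_gram (frame_conj fr).
move/eqP: m'n; rewrite (im_mulC l' l) dotNr oppr_eq0 => /eqP m'n.
case: fr => [[ll ll' a0] [kk kk' b0] lk lk' l'k l'k' _ _].
set m := im_mul l k' in lm l'm km k'm mm mm' mn *.
set m' := im_mul l' k in lm' l'm' km' k'm' m'm' mm' m'n *.
set n := im_mul l l' in ln l'n kn k'n mn m'n nn *.
set a := dot l l' in a0 mm' nn *; set b := dot k k' in b0 mm' *.
pose c := (2 * a * b)^-1.
have c0 : 2 * a * b != 0 by rewrite !mulf_neq0 // pnatr_eq0.
pose vs := [:: l; l'; k; k'; m; m'; n].
pose ws := [:: a^-1 *: l'; a^-1 *: l; b^-1 *: k'; b^-1 *: k; c *: m'; c *: m;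
             (- (a ^+ 2)^-1) *: n].
have Z := (lm, l'm, km, k'm, l'm', lm', k'm', km', ln, l'n, kn, k'n, mm, mn,
  m'm', m'n, ll, ll', kk, kk', lk, lk', l'k, l'k', mm').
(* The Gram table; each product is known up to the order of its factors. *)
have wv (i j : 'I_7) : dot ws`_i vs`_j = (i == j)%:R.
  case: i j => i hi [j hj] /=; rewrite -val_eqE /=.
  move: i hi j hj; do 7?[case=> //]; move=> _; do 7?[case=> //]; move=> _ /=;
    rewrite dotZl /c; first [ by rewrite Z mulr0 | by rewrite dotC Z mulr0
      | by rewrite ?Z mulVf | by rewrite dotC ?Z mulVf
      | by rewrite nn mulrNN mulVf ?expf_neq0 ].
rewrite {1}(dual_basis_expansion e wv) !big_ord_recl big_ord0 /= !dotZl.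
rewrite le l'e ke k'e !mulr0 !scale0r !add0r addr0 addrA mulNr scaleNr.
by rewrite ![_ / _]mulrC.
Qed.

Lemma frame_perp_mul_l l l' k k' e e' : coassoc_frame l l' k k' ->
  perp_frame l l' k k' e -> perp_frame l l' k k' e' -> dot (im_mul l e) e' = 0.
Proof.
move=> fr pe [le' _ ke' _]; have [lm lm' ln] := frame_mul_l fr.
rewrite (frame_expansion fr pe) !(im_mulDr, im_mulZr, im_mulNr) lm lm' ln.
by rewrite !(dotDl, dotNl, dotZl, dot0l) le' ke' !mulr0 oppr0 !addr0.
Qed.

(** The orthogonal of the frame is closed under the product: complexified, it
    is an associative three-space. *)
Lemma frame_perp_mul l l' k k' e e' (x1 x2 x3 x4 : F) :
  coassoc_frame l l' k k' ->
  perp_frame l l' k k' e -> perp_frame l l' k k' e' ->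
  dot (im_mul (x1 *: l + x2 *: l' + x3 *: k + x4 *: k') e) e' = 0.
Proof.
move=> fr pe pe'; rewrite !(im_mulDl, im_mulZl, dotDl, dotZl).
have sw u : perp_frame l l' k k' u -> perp_frame k k' l l' u by case.
have cj v v' w w' u : perp_frame v v' w w' u -> perp_frame v' v w' w u by case.
rewrite (frame_perp_mul_l fr) //.
rewrite (frame_perp_mul_l (frame_conj fr)); [|exact: cj..].
rewrite (frame_perp_mul_l (frame_swap fr)); [|exact: sw..].
rewrite (frame_perp_mul_l (frame_conj (frame_swap fr))); [|exact/cj/sw..].
by rewrite !mulr0 !addr0.
Qed.

Definition frame_comb l l' k k' (x : 'rV[F]_4) : 'cV[F]_7 :=
  x 0 0 *: l + x 0 1 *: l' + x 0 (inord 2) *: k + x 0 (inord 3) *: k'.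

Lemma perp_frame_mul l l' k k' x y : coassoc_frame l l' k k' ->
  perp_frame l l' k k'
    (im_mul (frame_comb l l' k k' x) (frame_comb l l' k k' y)).
Proof.
move=> fr; have [ln l'n kn k'n] := frame_perp_diag fr.
have [lm l'm km k'm] := frame_perp_mixed fr.
have [l'm' lm' k'm' km'] := frame_perp_mixed (frame_conj fr).
rewrite (frame_mul_span _ _ _ _ _ _ _ _ fr); split; rewrite !(dotDr, dotZr).
- by rewrite ln lm lm' !mulr0 !addr0.
- by rewrite l'n l'm l'm' !mulr0 !addr0.
- by rewrite kn km km' !mulr0 !addr0.
- by rewrite k'n k'm k'm' !mulr0 !addr0.
Qed.

Lemma perp_frame_comb l l' k k' x e :
  perp_frame l l' k k' e -> dot (frame_comb l l' k k' x) e = 0.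
Proof.
case=> le l'e ke k'e; rewrite !(dotDl, dotZl) le l'e ke k'e.
by rewrite !mulr0 !addr0.
Qed.

Lemma frame_split l l' k k' v : coassoc_frame l l' k k' ->
  exists x e, perp_frame l l' k k' e /\ v = frame_comb l l' k k' x + e.
Proof.
case=> [[ll ll' a0] [kk kk' b0] lk lk' l'k l'k' _ _].
pose x : 'rV[F]_4 := \row_i [:: dot l' v / dot l l'; dot l v / dot l l';
                    dot k' v / dot k k'; dot k v / dot k k']`_i.
exists x, (v - frame_comb l l' k k' x); split; last by rewrite addrC subrK.
rewrite /frame_comb !mxE !inordK //=; split; rewrite !(dotDr, dotNr, dotZr).
- by rewrite ll lk lk' divfK // !mulr0 add0r !addr0 subrr.
- by rewrite ll' (dotC l' l) l'k l'k' divfK // !mulr0 !addr0 subrr.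
- by rewrite kk (dotC k l) (dotC k l') lk l'k divfK // !mulr0 !add0r subrr.
- rewrite kk' (dotC k' l) (dotC k' l') (dotC k' k) lk' l'k' divfK //.
  by rewrite !mulr0 !addr0 add0r subrr.
Qed.

Lemma triple_split u1 u2 u3 e1 e2 e3 :
  dot (im_mul u1 u2) u3 = 0 -> dot (im_mul u1 e2) e3 = 0 ->
  dot (im_mul u2 e1) e3 = 0 -> dot (im_mul u3 e1) e2 = 0 ->
  dot (im_mul (u1 + e1) (u2 + e2)) (u3 + e3) =
  dot (im_mul u1 u2) e3 + dot (im_mul u2 u3) e1 +
  dot (im_mul u3 u1) e2 + dot (im_mul e1 e2) e3.
Proof.
move=> h0 h1 h2 h3.
have h3' : dot (im_mul e1 e2) u3 = 0 by rewrite dotC -dot_mulA.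
have h2' : dot (im_mul e1 u2) e3 = 0 by rewrite im_mulC dotNl h2 oppr0.
have c1 : dot (im_mul u1 e2) u3 = dot (im_mul u3 u1) e2.
  by rewrite [LHS]dotC -dot_mulA.
have c2 : dot (im_mul e1 u2) u3 = dot (im_mul u2 u3) e1.
  by rewrite [RHS]dotC -dot_mulA.
rewrite !(im_mulDl, im_mulDr, dotDl, dotDr) h0 h1 h2' h3' c1 c2.
by ring.
Qed.

(** The form <x y, z> has no component with exactly three or exactly one
    argument in the span of the frame. So a map that fixes the orthogonal of the
    frame preserves the form as soon as it preserves products in the span. *)
Lemma frame_triple l l' k k' x1 x2 x3 e1 e2 e3 : coassoc_frame l l' k k' ->
  perp_frame l l' k k' e1 -> perp_frame l l' k k' e2 ->
  perp_frame l l' k k' e3 ->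
  let u x := frame_comb l l' k k' x in
  dot (im_mul (u x1 + e1) (u x2 + e2)) (u x3 + e3) =
  dot (im_mul (u x1) (u x2)) e3 + dot (im_mul (u x2) (u x3)) e1 +
  dot (im_mul (u x3) (u x1)) e2 + dot (im_mul e1 e2) e3.
Proof.
move=> fr p1 p2 p3 u.
have uuu x y z : dot (im_mul (u x) (u y)) (u z) = 0.
  by rewrite dotC; apply/perp_frame_comb/perp_frame_mul.
have uee x e e' : perp_frame l l' k k' e -> perp_frame l l' k k' e' ->
    dot (im_mul (u x) e) e' = 0 by exact: (frame_perp_mul _ _ _ _ fr).
by apply: triple_split; [exact: uuu|exact: uee..].
Qed.

End Frame.

(** * Products of two simple factors preserve the octonion product *)

Section Automorphism.
Variable F : numFieldType.
Implicit Types (k l m n u v w e : 'cV[F]_7) (p q : F) (x y z : 'rV[F]_4).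

Lemma hrot_frame_comb l l' k k' p q c c' x : coassoc_frame l l' k k' ->
  dot (k + c *: l') (k' + c' *: l) != 0 ->
  exists y,
  [/\ hrot p q l l' *m
        (hrot p q (k + c *: l') (k' + c' *: l) *m frame_comb l l' k k' x)
      = frame_comb l l' k k' y
    & let t := dot k k' + c * c' * dot l l' in
      let s := (dot k k' * x 0 (inord 3) + c * dot l l' * x 0 0) / t in
      let r := (dot k k' * x 0 (inord 2) + c' * dot l l' * x 0 1) / t in
      [/\ y 0 0 = (1 + q) * (x 0 0 + p * c' * s),
          y 0 1 = (1 + p) * (x 0 1 + q * c * r),
          y 0 (inord 2) = x 0 (inord 2) + q * r &
          y 0 (inord 3) = x 0 (inord 3) + p * s]].
Proof.
case=> [[ll ll' a0] [kk kk' b0] lk lk' l'k l'k' _ _].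
have tE : dot (k + c *: l') (k' + c' *: l) = dot k k' + c * c' * dot l l'.
  rewrite !(dotDl, dotDr, dotZl, dotZr) (dotC k l) lk l'k' (dotC l' l).
  by ring.
rewrite tE => t0.
pose t := dot k k' + c * c' * dot l l'.
pose s := (dot k k' * x 0 (inord 3) + c * dot l l' * x 0 0) / t.
pose r := (dot k k' * x 0 (inord 2) + c' * dot l l' * x 0 1) / t.
exists (\row_i [:: (1 + q) * (x 0 0 + p * c' * s);
                  (1 + p) * (x 0 1 + q * c * r);
                  x 0 (inord 2) + q * r; x 0 (inord 3) + p * s]`_i).
split; last by rewrite !mxE !inordK.
rewrite !hrotE tE -/t /frame_comb ![in RHS]mxE !inordK //=.
rewrite !(dotDl, dotDr, dotZl, dotZr) ll ll' kk kk'.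
rewrite (dotC l' l) (dotC k l) (dotC k' l) (dotC k l') (dotC k' l').
rewrite (dotC k' k) lk lk' l'k l'k' /s /r.
by apply/matrixP=> i j; rewrite !mxE; field; rewrite a0 t0.
Qed.

Lemma hrot_hrot_perp l l' k k' p q c c' e : perp_frame l l' k k' e ->
  hrot p q l l' *m (hrot p q (k + c *: l') (k' + c' *: l) *m e) = e.
Proof.
case=> le l'e ke k'e; rewrite !hrotE !(dotDl, dotZl) le l'e ke k'e.
rewrite !(mulr0, addr0, mul0r, scale0r) le l'e.
by rewrite !(mulr0, mul0r, scale0r, addr0).
Qed.

(** Here k + c l' is an arbitrary isotropic vector of the plane <k, l'> off
    the line of l'. The two rotations act trivially on the orthogonal of the
    frame; on the plane <k, l'> one has determinant 1 + p and the other 1 + q,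
    so that their product lies in SL_2. *)
Lemma hrot_hrot_preserves_triple l l' k k' p q c c' :
  coassoc_frame l l' k k' -> p + q + p * q = 0 ->
  dot (k + c *: l') (k' + c' *: l) != 0 ->
  let P v := hrot p q l l' *m (hrot p q (k + c *: l') (k' + c' *: l) *m v) in
  forall u v w, dot (im_mul (P u) (P v)) (P w) = dot (im_mul u v) w.
Proof.
move=> fr pq t0 P.
have p1 : 1 + p != 0.
  apply: contra_eqN pq => /eqP p1.
  have -> : p + q + p * q = (1 + p) * (1 + q) - 1 by ring.
  by rewrite p1 mul0r sub0r oppr_eq0 oner_eq0.
have qE : q = (1 + p)^-1 - 1.
  apply: (mulfI p1); rewrite mulrBr mulfV // mulr1.
  transitivity ((p + q + p * q) - p); first by ring.
  by rewrite pq; ring.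
have PUU x x' :
    im_mul (P (frame_comb l l' k k' x)) (P (frame_comb l l' k k' x')) =
    im_mul (frame_comb l l' k k' x) (frame_comb l l' k k' x').
  have [y [Py [y0 y1 y2 y3]]] := hrot_frame_comb p q x fr t0.
  have [y' [Py' [y'0 y'1 y'2 y'3]]] := hrot_frame_comb p q x' fr t0.
  rewrite /P Py Py' /frame_comb !(frame_mul_span _ _ _ _ _ _ _ _ fr).
  have tE : dot (k + c *: l') (k' + c' *: l) = dot k k' + c * c' * dot l l'.
    case: (fr) => _ _ lk _ _ l'k' _ _.
    rewrite !(dotDl, dotDr, dotZl, dotZr) (dotC k l) lk l'k' (dotC l' l).
    by ring.
  rewrite tE in t0; rewrite y0 y1 y2 y3 y'0 y'1 y'2 y'3 qE.
  case: (fr) => [[_ _ a0] _ _ _ _ _ _ _].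
  by congr (_ *: _ + _ *: _ + _ *: _); field; rewrite ?a0 ?t0 p1.
move=> u v w.
have [x1 [e1 [p1' ->]]] := frame_split u fr.
have [x2 [e2 [p2' ->]]] := frame_split v fr.
have [x3 [e3 [p3' ->]]] := frame_split w fr.
have PD x e : perp_frame l l' k k' e ->
    P (frame_comb l l' k k' x + e) = P (frame_comb l l' k k' x) + e.
  by move=> pe; rewrite /P !mulmxDr (hrot_hrot_perp _ _ _ _ pe).
rewrite !PD // (frame_triple x1 x2 x3 fr p1' p2' p3').
have [y1 [Py1 _]] := hrot_frame_comb p q x1 fr t0.
have [y2 [Py2 _]] := hrot_frame_comb p q x2 fr t0.
have [y3 [Py3 _]] := hrot_frame_comb p q x3 fr t0.
rewrite -!PUU /P Py1 Py2 Py3.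
exact: (frame_triple y1 y2 y3 fr p1' p2' p3').
Qed.

End Automorphism.

(** * Isotropic lines and the loops attached to them *)

Section Lines.
Variable C : numClosedFieldType.
Implicit Types (u v w k l m n : 'cV[C]_7) (U L K : {vspace 'cV[C]_7}).

Lemma conj_colD u v : conj_col (u + v) = conj_col u + conj_col v.
Proof. exact: map_mxD. Qed.

Lemma conj_colZ c v : conj_col (c *: v) = c^* *: conj_col v.
Proof. exact: map_mxZ. Qed.

Lemma conj_col0 : conj_col 0 = 0 :> 'cV[C]_7.
Proof. exact: map_mx0. Qed.

Lemma conj_col_eq0 v : (conj_col v == 0) = (v == 0).
Proof.
apply/eqP/eqP => [e|->]; last exact: conj_col0.
by rewrite -(conj_colK v) e conj_col0.
Qed.

Lemma dot_conj u v : dot (conj_col u) (conj_col v) = (dot u v)^*.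
Proof.
by rewrite rmorph_sum; apply: eq_bigr => i _; rewrite !mxE rmorphM.
Qed.

Lemma im_mul_conj u v :
  im_mul (conj_col u) (conj_col v) = conj_col (im_mul u v).
Proof.
apply/matrixP=> -[i hi] j; rewrite !mxE /=.
move: i hi; do 7?[case=> //]; move=> _ /=; rewrite !mxE;
  by rewrite !(rmorphD, rmorphB, rmorphN, rmorphM, rmorph0).
Qed.

Lemma dot_conj_neq0 v : v != 0 -> dot v (conj_col v) != 0.
Proof.
apply: contra_neqN => /eqP v0; apply/matrixP=> i j; rewrite ord1 mxE.
have nn h : true -> 0 <= v h 0 * conj_col v h 0.
  by move=> _; rewrite mxE mul_conjC_ge0.
move/eqP: v0; rewrite /dot psumr_eq0 // => /allP/(_ i).
by rewrite mem_index_enum mxE mul_conjC_eq0 => /(_ isT) /eqP.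
Qed.

Lemma hyp_pair_conj v : v != 0 -> dot v v = 0 -> hyp_pair v (conj_col v).
Proof.
by move=> v0 vv; split; rewrite ?dot_conj ?vv ?rmorph0 ?dot_conj_neq0.
Qed.

Lemma conjv_line l : conjv <[l]> = <[conj_col l]>%VS.
Proof.
apply/vspaceP => v; rewrite memv_conjv.
apply/vlineP/vlineP => -[c e]; exists c^*.
  by rewrite -(conj_colK v) e conj_colZ.
by rewrite e conj_colZ conj_colK.
Qed.

Lemma imgv_line (A : 'M[C]_7) l : imgv A <[l]> = <[A *m l]>%VS.
Proof. by rewrite /imgv limg_line lfunE. Qed.

Lemma isotropic_lineP L : isotropic_line L <->
  exists l, [/\ L = <[l]>%VS, l != 0 & dot l l = 0].
Proof.
split=> [[L1 Liso]|[l [-> l0 ll]]].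
  have l0 : vpick L != 0 by rewrite vpick0 -dimv_eq0 L1.
  exists (vpick L); split=> //; last by apply: Liso; rewrite memv_pick.
  by apply/esym/eqP; rewrite eqEdim dim_vline l0 L1 andbT -memvE memv_pick.
split; first by rewrite dim_vline l0.
move=> u v /vlineP[c ->] /vlineP[d ->].
by rewrite dotZl dotZr ll !mulr0.
Qed.

Lemma memv_orth_line l v : v \in orthv (<[l]> + conjv <[l]>)%VS <->
  dot l v = 0 /\ dot (conj_col l) v = 0.
Proof.
rewrite conjv_line; split=> [/memv_orthv vL|[lv l'v]].
  split; apply: vL.
    by apply: (subvP (addvSl _ _)); rewrite memv_line.
  by apply: (subvP (addvSr _ _)); rewrite memv_line.
apply/memv_orthv => u /memv_addP[x /vlineP[c ->]] [y /vlineP[d ->] ->].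
by rewrite dotDl !dotZl lv l'v !mulr0 addr0.
Qed.

Lemma daddv_pi_eq (U W : {vspace 'cV[C]_7}) u w :
  (forall x, x \in U -> x \in W -> x = 0) ->
  u \in U -> w \in W -> daddv_pi U W (u + w) = u.
Proof.
move=> UW uU wW.
have cap : (U :&: W = 0)%VS.
  apply/eqP; rewrite -subv0; apply/subvP => x; rewrite memv_cap memv0.
  by case/andP=> xU xW; rewrite (UW x).
have capC : (W :&: U = 0)%VS by rewrite capvC.
rewrite linearD /= (daddv_pi_id cap uU).
have := daddv_pi_add cap (subvP (addvSr U W) w wW).
rewrite (daddv_pi_id capC wW) => /(canRL (addrK _)); rewrite subrr => ->.
by rewrite addr0.
Qed.

Definition perp_proj l : 'M[C]_7 :=
  1%:M - proj l (conj_col l) - proj (conj_col l) l.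

Lemma line_projections l : l != 0 -> dot l l = 0 ->
  [/\ pi_line <[l]> = proj (conj_col l) l, pi_conj <[l]> = proj l (conj_col l)
    & pi_orth <[l]> = perp_proj l].
Proof.
move=> l0 ll; have [_ l'l' a0] := hyp_pair_conj l0 ll.
set l' := conj_col l in l'l' a0 *; pose O := orthv (<[l]> + conjv <[l]>).
have split v : perp_proj l *m v \in O.
  apply/memv_orth_line; rewrite !mulmxBl mul1mx !projE !(dotDr, dotNr, dotZr).
  rewrite -/l' ll l'l' (dotC l' l) !divfK //.
  by split; rewrite !mulr0 !(oppr0, subr0, addr0) subrr.
have vE v : v = (dot l' v / dot l l') *: l + perp_proj l *m v
    + (dot l v / dot l l') *: l'.
  rewrite !mulmxBl mul1mx !projE (dotC l' l).
  by apply/matrixP=> i j; rewrite !mxE; ring.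
have lL c : c *: l \in <[l]>%VS by rewrite memvZ ?memv_line.
have l'L c : c *: l' \in conjv <[l]> by rewrite conjv_line memvZ ?memv_line.
have l'P x : x \in conjv <[l]> -> exists c, x = c *: l'.
  by rewrite conjv_line => /vlineP.
have OP x : x \in O -> dot l x = 0 /\ dot l' x = 0 by move/memv_orth_line.
split; apply: mulmx_ext => v; rewrite mul_endmx.
- rewrite {1}[v]vE -addrA daddv_pi_eq ?projE ?(dotC l' l) ?memv_add //.
  move=> _ /vlineP[c ->] /memv_addP[y /OP[_ l'y]] [z].
  move=> /l'P[d ->] /(congr1 (dot l')).
  rewrite dotDr !dotZr l'y l'l' mulr0 addr0 => /eqP.
  by rewrite mulf_eq0 (dotC l') (negPf a0) orbF => /eqP ->; rewrite scale0r.
- rewrite {1}[v]vE addrC daddv_pi_eq ?projE ?memv_add //.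
  move=> _ /l'P[c ->] /memv_addP[z /vlineP[d ->]] [y /OP[ly _]].
  move/(congr1 (dot l)); rewrite dotDr !dotZr ly ll mulr0 addr0 => /eqP.
  by rewrite mulf_eq0 (negPf a0) orbF => /eqP ->; rewrite scale0r.
- rewrite {1}[v]vE addrAC addrC daddv_pi_eq ?memv_add //.
  move=> x /OP[lx l'x] /memv_addP[y /vlineP[c ->]] [z].
  move=> /l'P[d ->] xE; move: lx l'x; rewrite xE !dotDr !dotZr.
  rewrite ll l'l' (dotC l') !mulr0 add0r addr0 => /eqP.
  rewrite mulf_eq0 (negPf a0) orbF => /eqP -> /eqP.
  by rewrite mulf_eq0 (negPf a0) orbF => /eqP ->; rewrite !scale0r addr0.
Qed.

Definition ploop a l z : 'M[C]_7 := loop2 a a^* l (conj_col l) z.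

Lemma p1E a l z : l != 0 -> dot l l = 0 -> z != a -> z != a^* ->
  p1 a <[l]> z = ploop a l z.
Proof.
move=> l0 ll za za'; have [pL pC pO] := line_projections l0 ll.
rewrite /p1 pL pC pO /ploop /loop2 /hrot /perp_proj.
move: (proj l _) (proj _ l) => P Q.
rewrite -!(subr_eq0 z) in za za'.
have -> : (z - a^*) / (z - a) = 1 + (a - a^*) / (z - a) by field.
have -> : (z - a) / (z - a^*) = 1 + (a^* - a) / (z - a^*) by field.
by apply/matrixP=> i j; rewrite !mxE; ring.
Qed.

End Lines.

Import numFieldNormedType.Exports.

(** * Values at removable singularities *)

Section Limits.
Local Open Scope classical_set_scope.
Variable C : numClosedFieldType.
Implicit Types (u v w k l m n : 'cV[C]_7) (g x y : C).

Lemma near_neq g x : g != x -> \forall z \near g^', z != x.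
Proof.
move=> gx; have : \forall z \near g^', z - x != 0.
  apply: (@cvgr_neq0 _ C^o _ _ _ (fun z => z - x) (g - x)).
    by apply: cvgB; [exact/cvg_within|exact: cvg_cst].
  by rewrite subr_eq0.
by apply: filterS => z; rewrite subr_eq0.
Qed.

Lemma cvg_simple_pole (a : C) g x :
  g != x -> a / (z - x) @[z --> g^'] --> a / (g - x).
Proof.
move=> gx; apply: cvgMl_tmp; apply: cvgV; first by rewrite subr_eq0.
by apply: cvgB; [exact/cvg_within|exact: cvg_cst].
Qed.

Lemma cvg_loop2 x y k m g (A B : 'M[C]_7) : g != x -> g != y ->
  A *m loop2 x y k m z *m B @[z --> g^'] --> A *m loop2 x y k m g *m B.
Proof.
move=> gx gy; rewrite /loop2 /hrot.
have E z : A *m (1%:M + (x - y) / (z - x) *: proj k m +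
     (y - x) / (z - y) *: proj m k) *m B =
   A *m B + (x - y) / (z - x) *: (A *m proj k m *m B)
     + (y - x) / (z - y) *: (A *m proj m k *m B).
  by rewrite !(mulmxDr, mulmxDl) mulmx1 -!scalemxAr -!scalemxAl.
rewrite (_ : (fun z => _) = (fun z => A *m B
   + (x - y) / (z - x) *: (A *m proj k m *m B)
   + (y - x) / (z - y) *: (A *m proj m k *m B))); last by apply/funext.
rewrite E; apply: cvgD; [apply: cvgD|]; first exact: cvg_cst.
  by apply: cvgZr_tmp; exact: cvg_simple_pole.
by apply: cvgZr_tmp; exact: cvg_simple_pole.
Qed.

Lemma cvg_loop2_loop2 x y k m n l g (A B : 'M[C]_7) : g != x -> g != y ->
  A *m (loop2 x y k m z *m loop2 x y n l z) *m B @[z --> g^'] -->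
  A *m (loop2 x y k m g *m loop2 x y n l g) *m B.
Proof.
move=> gx gy; pose N z := loop2 x y n l z.
have E z : A *m (loop2 x y k m z *m N z) *m B =
   A *m N z *m B + (x - y) / (z - x) *: (A *m proj k m *m N z *m B)
     + (y - x) / (z - y) *: (A *m proj m k *m N z *m B).
  rewrite /loop2 /hrot -/(loop2 x y n l z) -/(N z); move: (N z) => M.
  rewrite !(mulmxDr, mulmxDl) mul1mx -!scalemxAl -!scalemxAr -!scalemxAl.
  by rewrite !mulmxA.
rewrite (_ : (fun z => _) = (fun z => A *m N z *m B
   + (x - y) / (z - x) *: (A *m proj k m *m N z *m B)
   + (y - x) / (z - y) *: (A *m proj m k *m N z *m B))); last by apply/funext.
rewrite E; apply: cvgD; [apply: cvgD|]; first exact: cvg_loop2.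
  by apply: cvgZ; [exact: cvg_simple_pole|exact: cvg_loop2].
by apply: cvgZ; [exact: cvg_simple_pole|exact: cvg_loop2].
Qed.

End Limits.

(** * Dressing of isotropic vectors *)

Section Dressing.
Local Open Scope classical_set_scope.
Variable C : numClosedFieldType.
Implicit Types (u v w k l m n : 'cV[C]_7) (a b x y z : C).
Implicit Types (L K : {vspace 'cV[C]_7}).

Definition null_vec v := v != 0 /\ dot v v = 0.

Lemma null_pair v : null_vec v -> hyp_pair v (conj_col v).
Proof. by case; exact: hyp_pair_conj. Qed.

Lemma conj_neq z x : (z^* != x^*) = (z != x).
Proof. by rewrite (inj_eq (inv_inj (@conjCK C))). Qed.

Lemma conj_neqr z x : (z^* != x) = (z != x^*).
Proof. by rewrite -conj_neq conjCK. Qed.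

Lemma conj_ploop a l z v :
  conj_col (ploop a l z *m v) = ploop a l z^* *m conj_col v.
Proof.
rewrite /ploop /loop2 !hrotE !conj_colD !conj_colZ conj_colK.
rewrite !(fmorph_div, rmorphM, rmorphB) /= !conjCK -!dot_conj conj_colK.
by rewrite (dotC (conj_col l) l) addrAC.
Qed.

Lemma dot_ploop a l z u v : null_vec l -> z != a -> z != a^* ->
  dot (ploop a l z *m u) (ploop a l z *m v) = dot u v.
Proof. by move=> /null_pair hl za za'; exact: dot_loop2. Qed.

Lemma ploop_inj a l z v : null_vec l -> z != a -> z != a^* ->
  ploop a l z *m v = 0 -> v = 0.
Proof.
move=> nl za za' v0; apply: dot_nondeg => w.
by rewrite -(dot_ploop _ _ nl za za') v0 dot0l.
Qed.

Lemma null_ploop a l z v : null_vec l -> z != a -> z != a^* -> null_vec v ->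
  null_vec (ploop a l z *m v).
Proof.
move=> nl za za' [v0 vv]; split; last by rewrite dot_ploop.
by apply: contra_neq v0; exact: ploop_inj.
Qed.

(** An isometry: its transpose is a left inverse. *)
Lemma ploop_unit a l z : null_vec l -> z != a -> z != a^* ->
  ploop a l z \in unitmx.
Proof.
move=> nl za za'.
suff /mulmx1_unit[] : (ploop a l z)^T *m ploop a l z = 1%:M by [].
apply/matrixP=> i j.
transitivity (dot (ploop a l z *m delta_mx i 0) (ploop a l z *m delta_mx j 0)).
  by rewrite !mxE -!colE; apply: eq_bigr => h _; rewrite !mxE.
rewrite dot_ploop // /dot mxE (bigD1 i) //= big1 ?addr0 => [|h /negPf hi].
  by rewrite !mxE !eqxx mul1r andbT.
by rewrite mxE hi mul0r.
Qed.

(** Each loop with poles at a and its conjugate is regular at b, and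
    conversely. *)
Lemma spectral_neq a b : a != b -> a != b^* ->
  [/\ b != a, b != a^*, a^* != b & a^* != b^*].
Proof.
by move=> ab ab'; rewrite conj_neq conj_neqr !(eq_sym b) conj_neqr.
Qed.

Lemma ploop_permute {a b k n} z : null_vec k -> null_vec n ->
  a != b -> a != b^* -> z != a -> z != a^* -> z != b -> z != b^* ->
  ploop a (ploop b n a *m k) z *m ploop b n z =
  ploop b (ploop a k b *m n) z *m ploop a k z.
Proof.
move=> nk nn ab ab' za za' zb zb'.
have [ba ba' a'b a'b'] := spectral_neq ab ab'.
have n1 : null_vec (ploop a k b *m n) by exact: null_ploop.
have [_ _ b10] := null_pair n1.
rewrite /ploop; move: b10; rewrite !conj_ploop => b10.
by apply: loop2_permute => //; exact: null_pair.
Qed.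

Lemma ploop_residue {a b k n} : null_vec k -> null_vec n ->
  a != b -> a != b^* -> exists c,
  ploop b (ploop a k b *m n) a *m conj_col k = c *: conj_col (ploop b n a *m k).
Proof.
move=> nk nn ab ab'.
have [ba ba' a'b a'b'] := spectral_neq ab ab'.
have n1 : null_vec (ploop a k b *m n) by exact: null_ploop.
have [_ _ b10] := null_pair n1.
rewrite /ploop; move: b10; rewrite !conj_ploop => b10.
by eexists; apply: loop2_residue => //; exact: null_pair.
Qed.

(** * Admissible pairs *)

Definition perp_part l k := k - (dot l k / dot l (conj_col l)) *: conj_col l.

(** Admissibility of a pair of lines, read on generators: [perp_part] is the
    component of k orthogonal to l and to its conjugate. *)
Definition adm_pair l k :=
  [/\ null_vec l, null_vec k, dot (conj_col l) k = 0, perp_part l k != 0 &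
      im_mul l (perp_part l k) = 0].

Lemma null_perp_part l k : adm_pair l k -> null_vec (perp_part l k).
Proof.
case=> -[l0 ll] [k0 kk] l'k p0 _; split=> //.
rewrite !(dotDl, dotDr, dotNl, dotNr, dotZl, dotZr) kk (dotC k (conj_col l)).
by rewrite l'k dot_conj ll rmorph0; ring.
Qed.

Lemma adm_pair_frame l k : adm_pair l k ->
  coassoc_frame l (conj_col l) (perp_part l k) (conj_col (perp_part l k)).
Proof.
move=> lk; have np := null_pair (null_perp_part lk).
case: lk => nl nk l'k p0 lp; have hl := null_pair nl; have [ll l'l' a0] := hl.
have lp0 : dot l (perp_part l k) = 0.
  by rewrite dotDr dotNr dotZr divfK // subrr.
have l'p0 : dot (conj_col l) (perp_part l k) = 0.
  by rewrite dotDr dotNr dotZr l'k l'l' mulr0 oppr0 addr0.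
split=> //.
- by rewrite -{1}(conj_colK l) dot_conj l'p0 rmorph0.
- by rewrite dot_conj lp0 rmorph0.
- by rewrite im_mul_conj lp conj_col0.
Qed.

(** The vectors l, k and their conjugates span the same space as the frame
    built from l and the orthogonal part of k. Expressed in that frame, the
    product of k and of the orthogonal part of l is a multiple of the product of
    l and its conjugate, and [frame_diag] shows that the coefficient is zero. *)
Lemma adm_pair_sym l k : adm_pair l k -> adm_pair k l.
Proof.
move=> lk; have fr := adm_pair_frame lk; have np := null_perp_part lk.
case: (lk) => nl nk l'k p0 lp; have [_ _ a0] := null_pair nl.
have [_ _ b0] := null_pair nk; have [_ _ c0] := null_pair np.
have k'l : dot (conj_col k) l = 0.
  by rewrite -[l]conj_colK dot_conj dotC l'k rmorph0.
have kl' : dot k (conj_col l) = 0 by rewrite dotC.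
have [g gE] : exists g, g = dot l k / dot l (conj_col l) by eexists.
have [p pE] : exists p, p = perp_part l k by eexists.
have kE : k = p + g *: conj_col l by rewrite pE gE subrK.
rewrite -pE in fr np p0 lp c0.
have k'E : conj_col k = conj_col p + g^* *: l.
  by rewrite {1}kE conj_colD conj_colZ conj_colK.
have bE : dot k (conj_col k) =
    dot p (conj_col p) + g * g^* * dot l (conj_col l).
  case: fr => _ _ e1 _ _ e2 _ _; rewrite {1}kE k'E.
  rewrite !(dotDl, dotDr, dotZl, dotZr) (dotC p l) e1 e2 (dotC _ l).
  by ring.
split=> //.
  apply: contra_neq p0 => q0.
  have lE : l = (dot k l / dot k (conj_col k)) *: conj_col k.
    by apply/eqP; rewrite -subr_eq0; apply/eqP.
  move: lE; set d := _ / _ => lE; have d0 : d != 0.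
    by case: nl => [l0 _]; apply: contra_neq l0 => d0; rewrite lE d0 scale0r.
  rewrite pE /perp_part lE conj_colZ conj_colK !(dotZl, dotZr).
  rewrite (dotC (conj_col k)) scalerA.
  have dc0 : d^* != 0 by rewrite conjC_eq0.
  suff -> :
      d * dot k (conj_col k) / (d * (d^* * dot k (conj_col k))) * d^* = 1.
    by rewrite scale1r subrr.
  by field; rewrite d0 dc0 b0.
have {}gE : dot k l = g * dot l (conj_col l) by rewrite gE dotC divfK.
have pp := frame_diag fr.
case: fr => _ _ _ _ _ _ lp' l'p'.
rewrite /perp_part gE bE k'E [in im_mul k]kE; rewrite bE in b0.
rewrite !(im_mulDl, im_mulDr, im_mulZl, im_mulZr, im_mulNr, im_mul_alt).
rewrite (im_mulC p l) lp' l'p' pp (im_mulC (conj_col l) l).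
by apply/matrixP=> i j; rewrite !mxE; field; rewrite b0 a0.
Qed.

(** The values of p_{b,M,N} lie in the complex group G_2. *)
Lemma adm_pair_preserves_triple m n b z u v w :
  adm_pair m n -> z != b -> z != b^* ->
  let P (t : 'cV[C]_7) := ploop b m z *m (ploop b n z *m t) in
  dot (im_mul (P u) (P v)) (P w) = dot (im_mul u v) w.
Proof.
move=> mn zb zb'; have fr := adm_pair_frame mn.
move=> P; rewrite {}/P /ploop /loop2.
case: mn => _ nn _ _ _; have [_ _ n0] := null_pair nn.
have [g gE] : exists g, g = dot m n / dot m (conj_col m) by eexists.
have [p pE] : exists p, p = perp_part m n by eexists.
have nE : n = p + g *: conj_col m by rewrite pE gE subrK.
rewrite -pE in fr; move: n0.
have n'E : conj_col n = conj_col p + g^* *: m.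
  by rewrite {1}nE conj_colD conj_colZ conj_colK.
rewrite n'E {}nE => n0.
by apply: hrot_hrot_preserves_triple => //; exact: loop2_weights.
Qed.

Lemma adm_pair_preserves_mul0 m n b z u v :
  adm_pair m n -> z != b -> z != b^* ->
  im_mul u v = 0 ->
  let P (t : 'cV[C]_7) := ploop b m z *m (ploop b n z *m t) in
  im_mul (P u) (P v) = 0.
Proof.
move=> mn zb zb' uv P; apply: dot_nondeg => w.
case: (mn) => nm nn _ _ _.
rewrite -[w](mulKVmx (ploop_unit nm zb zb')).
rewrite -[_ *m w](mulKVmx (ploop_unit nn zb zb')) /P.
by rewrite adm_pair_preserves_triple // uv dot0l.
Qed.

Lemma dot_perp_proj k v : null_vec k ->
  dot k (perp_proj k *m v) = 0 /\ dot (conj_col k) (perp_proj k *m v) = 0.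
Proof.
move=> /null_pair[kk k'k' a0]; rewrite !mulmxBl mul1mx !projE.
rewrite !(dotDr, dotNr, dotZr) kk k'k' (dotC (conj_col k) k) !divfK //.
by split; ring.
Qed.

Lemma perp_proj_perp k v :
  dot k v = 0 -> dot (conj_col k) v = 0 -> perp_proj k *m v = v.
Proof.
move=> kv k'v; rewrite !mulmxBl mul1mx !projE kv k'v !mul0r !scale0r.
by rewrite !subr0.
Qed.

Lemma perp_proj_conj k : null_vec k -> perp_proj k *m conj_col k = 0.
Proof.
move=> /null_pair[kk k'k' a0]; rewrite !mulmxBl mul1mx !projE k'k'.
by rewrite mul0r scale0r subr0 divff // scale1r subrr.
Qed.

Lemma perp_proj_line k : null_vec k -> perp_proj k *m k = 0.
Proof.
move=> /null_pair[kk k'k' a0]; rewrite !mulmxBl mul1mx !projE kk.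
by rewrite mul0r scale0r subr0 divff 1?dotC // scale1r subrr.
Qed.

Lemma ploop_perp_proj a k z :
  null_vec k -> ploop a k z *m perp_proj k = perp_proj k.
Proof.
move=> nk; apply: mulmx_ext => v; rewrite -mulmxA.
have [e1 e2] := dot_perp_proj v nk.
by rewrite hrotE e1 e2 !mulr0 !mul0r !scale0r !addr0.
Qed.

Lemma perp_proj_ploop a k z :
  null_vec k -> perp_proj k *m ploop a k z = perp_proj k.
Proof.
move=> nk; apply: mulmx_ext => v; rewrite -mulmxA hrotE !mulmxDr -!scalemxAr.
by rewrite perp_proj_conj // perp_proj_line // !scaler0 !addr0.
Qed.

(** Two single permutations carry the factor at a through both factors at b.
    It follows that p_{a,K'} * p_{b,M,N} is the product p_{b,M1} p_{b,N1}. *)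
Lemma ploop_permute_pair {a b k m n} z :
  null_vec k -> null_vec m -> null_vec n ->
  a != b -> a != b^* -> z != a -> z != a^* -> z != b -> z != b^* ->
  let k1 := ploop b n a *m k in
  let n1 := ploop a k b *m n in
  let m1 := ploop a k1 b *m m in
  ploop a (ploop b m a *m k1) z *m (ploop b m z *m ploop b n z) =
  ploop b m1 z *m ploop b n1 z *m ploop a k z.
Proof.
move=> nk nm nn ab ab' za za' zb zb' k1 n1 m1.
have nk1 : null_vec k1 by exact: null_ploop.
by rewrite mulmxA ploop_permute // -!mulmxA ploop_permute.
Qed.

(** Write Q for p_{b,M,N} and H for its dressing by K, so that
    p_{a,K'} Q = H p_{a,K}. Both simple factors at a are the identity modulo
    the line and its conjugate, so Q(a) and H(a) agree from the orthogonal of K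
    and its conjugate to that of K' and its conjugate; moreover H(a) sends the
    conjugate of K to the conjugate of K'. Hence the part of L' orthogonal to
    K' is, modulo K', the image under Q(a) of the part of L orthogonal to K, and
    its product with K' vanishes because Q(a) is an automorphism of the product.
    This proves the admissibility of the pair in reversed order. *)
Lemma dressing_adm_pair {a b l k m n} : adm_pair l k -> adm_pair m n ->
  a != a^* -> a != b -> a != b^* ->
  let k1 := ploop b n a *m k in
  let n1 := ploop a k b *m n in
  let m1 := ploop a k1 b *m m in
  adm_pair (ploop b m1 a *m ploop b n1 a *m l) (ploop b m a *m k1).
Proof.
move=> lk mn aa' ab ab' k1 n1 m1.
have [ba ba' a'b a'b'] := spectral_neq ab ab'.
have [nl nk _ _ _] := lk; have [nm nn _ _ _] := mn.
have kl := adm_pair_sym lk; have [_ _ k'l l0 kl0] := kl.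
have nk1 : null_vec k1 by exact: null_ploop.
have nn1 : null_vec n1 by exact: null_ploop.
have nm1 : null_vec m1 by exact: null_ploop.
set kk := ploop b m a *m k1; have nkk : null_vec kk by exact: null_ploop.
rewrite -mulmxA; set ll := ploop b m1 a *m _.
have nll : null_vec ll by do 2!apply: null_ploop => //.
apply: adm_pair_sym.
pose Q z := ploop b m z *m ploop b n z.
pose H z := ploop b m1 z *m ploop b n1 z.
pose sandwich (X : 'M[C]_7) := perp_proj kk *m X *m perp_proj k.
have QH : sandwich (Q a) = sandwich (H a).
  have cQ : sandwich (Q z) @[z --> a^'] --> sandwich (Q a).
    exact: cvg_loop2_loop2.
  have cH : sandwich (H z) @[z --> a^'] --> sandwich (H a).
    exact: cvg_loop2_loop2.
  (* The two sides agree for z near a and distinct from a. *)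
  apply: (cvg_unique (@norm_hausdorff C 'M[C]_7) cQ).
  apply: cvg_trans cH; apply: near_eq_cvg.
  near=> z.
  have za : z != a by near: z; exact: nbhs_dnbhs_neq.
  have za' : z != a^* by near: z; exact: near_neq.
  have zb : z != b by near: z; exact: near_neq.
  have zb' : z != b^* by near: z; exact: near_neq.
  have e : ploop a kk z *m Q z = H z *m ploop a k z.
    exact: ploop_permute_pair.
  transitivity (sandwich (ploop a kk z *m Q z)); rewrite /sandwich.
    by rewrite e mulmxA -[RHS]mulmxA ploop_perp_proj.
  by rewrite mulmxA perp_proj_ploop.
have [c Hk] : exists c, H a *m conj_col k = c *: conj_col kk.
  (* H is a product of two dressed factors: one residue identity for each. *)
  have [c1 e1] := ploop_residue nk nn ab ab'.
  have [c2 e2] := ploop_residue nk1 nm ab ab'.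
  by exists (c1 * c2); rewrite -mulmxA e1 -scalemxAr e2 scalerA.
have llE : ll = H a *m l by rewrite /ll mulmxA.
have dotH u v : dot (H a *m u) (H a *m v) = dot u v.
  by rewrite -!mulmxA !dot_ploop.
have dotQ u v : dot (Q a *m u) (Q a *m v) = dot u v.
  by rewrite -!mulmxA !dot_ploop.
have kkE : kk = Q a *m k by rewrite /kk /k1 mulmxA.
have Qmul u v : im_mul u v = 0 -> im_mul (Q a *m u) (Q a *m v) = 0.
  by move=> uv; rewrite -!mulmxA; exact: adm_pair_preserves_mul0.
move: (Q a) (H a) QH Hk llE dotH dotQ kkE Qmul.
move=> {Q H} Q H QH Hk llE dotH dotQ kkE Qmul.
have c0 : c != 0.
  case: nk => k0 _; apply: contra_neq k0 => c0.
  move: Hk; rewrite c0 scale0r => Hk; apply/eqP; rewrite -conj_col_eq0.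
  by apply/eqP/dot_nondeg => w; rewrite -dotH Hk dot0l.
have kkll : dot (conj_col kk) ll = 0.
  by apply: (mulfI c0); rewrite -dotZl -Hk llE dotH k'l mulr0.
have [lp lpE] : exists p, p = perp_part k l by eexists.
rewrite -lpE in l0 kl0.
have [_ _ b0] := null_pair nk.
have klp : dot k lp = 0 by rewrite lpE dotDr dotNr dotZr divfK // subrr.
have k'lp : dot (conj_col k) lp = 0.
  case: nk => _ kz; rewrite lpE dotDr dotNr dotZr k'l dot_conj kz rmorph0.
  by rewrite mulr0 subr0.
(* The K'-component of Q lp; the one along its conjugate is zero. *)
pose e := dot (conj_col kk) (Q *m lp) / dot (conj_col kk) kk.
have pE : perp_part kk ll = Q *m (lp - e *: k).
  have -> : perp_part kk ll = perp_proj kk *m ll.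
    by rewrite !mulmxBl mul1mx !projE kkll mul0r scale0r subr0.
  have -> : ll = H *m lp + (dot k l / dot k (conj_col k)) *: (H *m conj_col k).
    by rewrite scalemxAr -mulmxDr lpE subrK.
  rewrite Hk mulmxDr -!scalemxAr perp_proj_conj // !scaler0 addr0.
  have /(congr1 (fun M => M *m lp)) := QH.
  rewrite /sandwich -!mulmxA (perp_proj_perp klp k'lp) => <-.
  rewrite !mulmxBl mul1mx !projE mulmxBr -(scalemxAr e) -kkE.
  rewrite (dotC kk (conj_col kk)).
  by rewrite {1}kkE dotQ klp mul0r scale0r subr0.
split=> //.
  rewrite pE; apply: contra_neq l0 => Q0.
  have {}Q0 : lp - e *: k = 0 by apply: dot_nondeg => w; rewrite -dotQ Q0 dot0l.
  have ke : e * dot (conj_col k) k = 0.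
    by rewrite -dotZr -[e *: k]opprK -[- (_ *: _)](addKr lp) Q0 addr0 opprK.
  move/eqP: ke; rewrite mulf_eq0 (dotC _ k) (negPf b0) orbF => /eqP e0.
  by move: Q0; rewrite e0 scale0r subr0.
rewrite pE kkE; apply: Qmul.
by rewrite im_mulDr im_mulNr im_mulZr im_mul_alt kl0 scaler0 subr0.
Unshelve. all: by end_near.
Qed.

(** * From vectors back to lines *)

Lemma pi_orth_perp_part l k : null_vec l -> dot (conj_col l) k = 0 ->
  pi_orth <[l]> *m k = perp_part l k.
Proof.
move=> [l0 ll] l'k; have [_ _ ->] := line_projections l0 ll.
by rewrite !mulmxBl mul1mx !projE l'k mul0r scale0r subr0.
Qed.

Lemma memv_orth_conj l k :
  (<[k]> <= orthv (conjv <[l]>))%VS <-> dot (conj_col l) k = 0.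
Proof.
rewrite -memvE conjv_line; split=> [/memv_orthv e|l'k].
  by apply: e; exact: memv_line.
by apply/memv_orthv => _ /vlineP[c ->]; rewrite dotZl l'k mulr0.
Qed.

Lemma admissibleP L K : admissible L K <->
  exists l k, [/\ L = <[l]>%VS, K = <[k]>%VS & adm_pair l k].
Proof.
split=> [[/isotropic_lineP[l [-> l0 ll]] /isotropic_lineP[k [-> k0 kk]]]|].
  move=> /memv_orth_conj l'k; rewrite imgv_line pi_orth_perp_part // => co.
  exists l, k; split=> //; split=> //.
    case: co => d2 _ _; apply: contra_eq_neq d2 => ->.
    have /eqP -> : (<[0 : 'cV[C]_7]>%VS == 0%VS).
      by rewrite -dimv_eq0 dim_vline eqxx.
    by rewrite addv0 dim_vline l0.
  case: co => _ _; apply; first exact: (subvP (addvSl _ _) _ (memv_line _)).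
  exact: (subvP (addvSr _ _) _ (memv_line _)).
move=> [l [k [-> -> lk]]]; have fr := adm_pair_frame lk.
have [_ pp] := null_perp_part lk.
have [nl nk l'k p0 lp] := lk; have [[ll _ a0] _ lp0 _ l'p0 _ _ _] := fr.
have [l0 _] := nl; have [k0 kk] := nk.
split; [| |exact/memv_orth_conj|].
- by apply/isotropic_lineP; exists l.
- by apply/isotropic_lineP; exists k.
rewrite imgv_line pi_orth_perp_part //.
move: (perp_part l k) pp p0 lp lp0 l'p0 {fr} => p pp p0 lp lp0 l'p0.
have memP u : u \in (<[l]> + <[p]>)%VS -> exists c d, u = c *: l + d *: p.
  by move=> /memv_addP[_ /vlineP[c ->]] [_ /vlineP[d ->] ->]; exists c, d.
split.
- rewrite dimv_disjoint_sum ?dim_vline ?l0 ?p0 //; apply/eqP.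
  rewrite -subv0; apply/subvP => u; rewrite memv_cap => /andP[/vlineP[c ->]].
  move=> /vlineP[d] /(congr1 (dot (conj_col l))); rewrite !dotZr l'p0 mulr0.
  move/eqP; rewrite mulf_eq0 (dotC _ l) (negPf a0) orbF => /eqP ->.
  by rewrite scale0r mem0v.
- move=> _ _ /memP[c [d ->]] /memP[c' [d' ->]].
  by rewrite !(dotDl, dotDr, dotZl, dotZr) ll pp (dotC p) lp0; ring.
- move=> _ _ /memP[c [d ->]] /memP[c' [d' ->]].
  rewrite !(im_mulDl, im_mulDr, im_mulZl, im_mulZr) !im_mul_alt (im_mulC p) lp.
  by rewrite oppr0 !scaler0 !addr0.
Qed.

Lemma p2E a l k z : null_vec l -> null_vec k -> z != a -> z != a^* ->
  p2 a <[l]> <[k]> z = ploop a l z *m ploop a k z.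
Proof. by move=> [l0 ll] [k0 kk] za za'; rewrite /p2 !p1E. Qed.

Lemma star_cvg {a b k m n} : null_vec k -> null_vec m -> null_vec n ->
  a != a^* -> a != b -> a != b^* ->
  let k1 := ploop b n a *m k in
  let n1 := ploop a k b *m n in
  let m1 := ploop a k1 b *m m in
  star a (imgv (p2 b <[m]> <[n]> a) <[k]>) (p2 b <[m]> <[n]>) z @[z --> a^']
    --> ploop b m1 a *m ploop b n1 a.
Proof.
move=> nk nm nn aa' ab ab' k1 n1 m1.
have [ba ba' a'b a'b'] := spectral_neq ab ab'.
have nk1 : null_vec k1 by exact: null_ploop.
have nkk : null_vec (ploop b m a *m k1) by exact: null_ploop.
have := @cvg_loop2_loop2 C b b^* m1 (conj_col m1) n1 (conj_col n1)
  a 1%:M 1%:M ab ab'.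
rewrite !mulmx1 !mul1mx => /(cvg_trans _); apply; apply: near_eq_cvg.
near=> z.
have za : z != a by near: z; exact: nbhs_dnbhs_neq.
have za' : z != a^* by near: z; exact: near_neq.
have zb : z != b by near: z; exact: near_neq.
have zb' : z != b^* by near: z; exact: near_neq.
have Qu : p2 b <[m]> <[n]> a \in unitmx.
  by rewrite p2E // unitmx_mul !ploop_unit.
have kkE : p2 b <[m]> <[n]> a *m k = ploop b m a *m k1.
  by rewrite p2E // -mulmxA.
have e : ploop a (ploop b m a *m k1) z *m (ploop b m z *m ploop b n z) =
    ploop b m1 z *m ploop b n1 z *m ploop a k z.
  exact: (ploop_permute_pair nk nm nn ab ab' za za' zb zb').
have uk := ploop_unit nk za za'.
case: (nkk) (nk) => kk0 kkkk [k0 kk].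
rewrite mulmx1 mul1mx /star !imgv_line (mulKmx Qu) kkE.
rewrite (p1E kk0 kkkk za za') (p1E k0 kk za za') (p2E nm nn zb zb') e.
by rewrite (mulmxK uk).
Unshelve. all: by end_near.
Qed.

(** Complex numbers enter only through conjugation and the topology of the
    norm, so the argument is carried out over any such field. *)
Lemma admissible_permute {L K} (M N : {vspace 'cV[C]_7}) {alpha beta : C} :
  admissible L K -> admissible M N ->
  alpha \isn't Num.real -> beta \isn't Num.real ->
  alpha != beta -> alpha != beta^* ->
  let K' := imgv (p2 beta M N alpha) K in
  let L' := imgv (value_at (star alpha K' (p2 beta M N)) alpha) L in
  let N' := imgv (p2 alpha L K beta) N in
  let M' := imgv (value_at (star beta N' (p2 alpha L K)) beta) M in
  [/\ removable_at (star alpha K' (p2 beta M N)) alpha,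
      removable_at (star beta N' (p2 alpha L K)) beta,
      admissible L' K', admissible M' N' &
      forall lambda : C,
        lambda \notin [:: alpha; alpha^*; beta; beta^*] ->
        p2 alpha L' K' lambda *m p2 beta M N lambda =
        p2 beta M' N' lambda *m p2 alpha L K lambda].
Proof.
move=> /admissibleP[l [k [-> -> lk]]] /admissibleP[m [n [-> -> mn]]].
move=> ar br ab ab'.
have aa' : alpha != alpha^* by rewrite eq_sym -CrealE.
have bb' : beta != beta^* by rewrite eq_sym -CrealE.
have [ba ba' a'b a'b'] := spectral_neq ab ab'.
have [nl nk _ _ _] := lk; have [nm nn _ _ _] := mn.
pose k1 := ploop beta n alpha *m k; pose n1 := ploop alpha k beta *m n.
pose kk := ploop beta m alpha *m k1; pose nn' := ploop alpha l beta *m n1.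
pose m1 := ploop alpha k1 beta *m m; pose l1 := ploop beta n1 alpha *m l.
pose ll := ploop beta m1 alpha *m l1; pose mm := ploop alpha l1 beta *m m1.
move=> K' L' N' M'.
have cA : star alpha K' (p2 beta <[m]> <[n]>) z @[z --> alpha^'] -->
    ploop beta m1 alpha *m ploop beta n1 alpha.
  exact: (star_cvg nk nm nn aa' ab ab').
have cB : star beta N' (p2 alpha <[l]> <[k]>) z @[z --> beta^'] -->
    ploop alpha l1 beta *m ploop alpha k1 beta.
  exact: (star_cvg nn nl nk bb' ba ba').
have nk1 : null_vec k1 by exact: null_ploop.
have nn1 : null_vec n1 by exact: null_ploop.
have nm1 : null_vec m1 by exact: null_ploop.
have nl1 : null_vec l1 by exact: null_ploop.
have K'E : K' = <[kk]>%VS by rewrite /K' p2E // imgv_line -mulmxA.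
have N'E : N' = <[nn']>%VS by rewrite /N' p2E // imgv_line -mulmxA.
have L'E : L' = <[ll]>%VS.
  by rewrite /L' /value_at (cvg_lim (@norm_hausdorff _ _) cA) imgv_line -mulmxA.
have M'E : M' = <[mm]>%VS.
  by rewrite /M' /value_at (cvg_lim (@norm_hausdorff _ _) cB) imgv_line -mulmxA.
have llkk : adm_pair ll kk.
  by rewrite /ll /l1 mulmxA; exact: dressing_adm_pair.
have mmnn : adm_pair mm nn'.
  by rewrite /mm /m1 mulmxA; exact: dressing_adm_pair.
split.
- exact: cvgP cA.
- exact: cvgP cB.
- by rewrite L'E K'E; apply/admissibleP; exists ll, kk.
- by rewrite M'E N'E; apply/admissibleP; exists mm, nn'.
move=> z; rewrite !inE !negb_or => /and4P[za za' zb zb'].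
have [nll nkk _ _ _] := llkk; have [nmm nnn _ _ _] := mmnn.
rewrite L'E K'E M'E N'E !p2E // -!mulmxA.
have e0 : ploop alpha kk z *m (ploop beta m z *m ploop beta n z) =
    ploop beta m1 z *m ploop beta n1 z *m ploop alpha k z.
  exact: (ploop_permute_pair nk nm nn ab ab' za za' zb zb').
have e1 : ploop alpha ll z *m ploop beta m1 z =
    ploop beta mm z *m ploop alpha l1 z.
  exact: (ploop_permute nl1 nm1 ab ab' za za' zb zb').
have e2 : ploop alpha l1 z *m ploop beta n1 z =
    ploop beta nn' z *m ploop alpha l z.
  exact: (ploop_permute nl nn1 ab ab' za za' zb zb').
by rewrite e0 -mulmxA mulmxA e1 -mulmxA (mulmxA (ploop alpha l1 z)) e2 -!mulmxA.
Qed.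

End Dressing.

Theorem corollary6p11 (R : realType) (L K M N : {vspace 'cV[R[i]]_7})
    (alpha beta : R[i]) :
  admissible L K -> admissible M N ->
  alpha \isn't Num.real -> beta \isn't Num.real ->
  alpha != beta -> alpha != beta^* ->
  let K' := imgv (p2 beta M N alpha) K in
  let L' := imgv (value_at (star alpha K' (p2 beta M N)) alpha) L in
  let N' := imgv (p2 alpha L K beta) N in
  let M' := imgv (value_at (star beta N' (p2 alpha L K)) beta) M in
  [/\ removable_at (star alpha K' (p2 beta M N)) alpha,
      removable_at (star beta N' (p2 alpha L K)) beta,
      admissible L' K', admissible M' N' &
      forall lambda : R[i],
        lambda \notin [:: alpha; alpha^*; beta; beta^*] ->
        p2 alpha L' K' lambda *m p2 beta M N lambda =
        p2 beta M' N' lambda *m p2 alpha L K lambda].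
Proof. exact: admissible_permute. Qed.
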